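(* Let $d\in\mathbb{N}$ be a non-square, $K=\mathbb{Q}(\sqrt d)$ with non-trivial Galois automorphism $x\mapsto\bar x$, and $\mathcal{O}=\mathbb{Z}+\mathbb{Z}\sqrt d\subseteq K$. Let $\epsilon\in\mathcal{O}^*$ be a unit of infinite order with $\epsilon\bar\epsilon=1$. Let $D_\infty=\langle A,\tau \mid \tau^2=(A\tau)^2=1\rangle$ be the infinite dihedral group, acting on the abelian group $F=\mathcal{O}\times\mathbb{Z}$ by $$A\cdot(m,n)=(\epsilon m,n),\qquad \tau\cdot(m,n)=(\bar m,-n)\qquad (m\in\mathcal{O},\ n\in\mathbb{Z}),$$ and let $\Gamma(\epsilon)=F\rtimes D_\infty$ be the corresponding split extension. Then the automorphism group $\mathrm{Aut}(\Gamma(\epsilon))$ does not contain an arithmetic group of finite index, i.e. no finite index subgroup of $\mathrm{Aut}(\Gamma(\epsilon))$ is an arithmetic group.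
   Context: A $\mathbb{Q}$-defined linear algebraic group is a subgroup $G\le \mathrm{GL}(n,\mathbb{C})$ ($n\in\mathbb{N}$) which is also an affine algebraic set defined by polynomials with rational coefficients in the natural coordinates of $\mathrm{GL}(n,\mathbb{C})$; for a subring $R\le\mathbb{C}$ put $G(R)=G\cap \mathrm{GL}(n,R)$. A subgroup $\Delta\le G(\mathbb{Q})$ is an arithmetic subgroup of $G$ if $\Delta\cap G(\mathbb{Z})$ has finite index in both $\Delta$ and $G(\mathbb{Z})$. An abstract group is called arithmetic if it is isomorphic to an arithmetic subgroup of some $\mathbb{Q}$-defined linear algebraic group. *)

(* Defs.v *)
From HB Require Import structures.
From mathcomp Require Import all_boot all_order all_fingroup all_algebra all_field.
From mathcomp Require Import boolp classical_sets functions cardinality reals.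
From mathcomp Require Import complex.
From mathcomp Require mpoly.

Set Implicit Arguments.
Unset Strict Implicit.
Unset Printing Implicit Defensive.

Import GRing.Theory.

Local Open Scope classical_set_scope.
Local Open Scope ring_scope.

Definition is_subgroup (T : groupType) (H : set T) : Prop :=
  H 1%g /\ forall x y, H x -> H y -> H (x * y^-1)%g.

Definition left_coset (T : groupType) (x : T) (H : set T) : set T :=
  [set (x * h)%g | h in H].

(* Meant for subgroups H and G. *)
Definition finite_index (T : groupType) (H G : set T) : Prop :=
  H `<=` G /\ finite_set [set left_coset x H | x in G].

Definition subgroup_iso (T U : groupType) (H : set T) (K : set U) : Prop :=
  exists f : T -> U,
    set_bij H K f /\ forall x y, H x -> H y -> f (x * y)%g = (f x * f y)%g.

Section GeneralLinear.
Variables (n : nat) (R : comUnitRingType).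

Record GL := MkGL { GLmx :> 'M[R]_n; GL_unit : GLmx \in unitmx }.

HB.instance Definition _ := [isSub for GLmx].
HB.instance Definition _ := [Choice of GL by <:].

Fact GL_one_unit : (1%:M : 'M[R]_n) \in unitmx. Proof. exact: unitmx1. Qed.
Fact GL_mul_unit (x y : GL) : x *m y \in unitmx.
Proof. by rewrite unitmx_mul !GL_unit. Qed.
Fact GL_inv_unit (x : GL) : invmx x \in unitmx.
Proof. by rewrite unitmx_inv GL_unit. Qed.

Definition GL_one := MkGL GL_one_unit.
Definition GL_mul (x y : GL) := MkGL (GL_mul_unit x y).
Definition GL_inv (x : GL) := MkGL (GL_inv_unit x).

Fact GL_mulA : associative GL_mul.
Proof. by move=> x y z; apply: val_inj; rewrite /= mulmxA. Qed.
Fact GL_mul1 : left_id GL_one GL_mul.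
Proof. by move=> x; apply: val_inj; rewrite /= mul1mx. Qed.
Fact GL_mulr1 : right_id GL_one GL_mul.
Proof. by move=> x; apply: val_inj; rewrite /= mulmx1. Qed.
Fact GL_mulV : left_inverse GL_one GL_inv GL_mul.
Proof. by move=> x; apply: val_inj; rewrite /= mulVmx ?GL_unit. Qed.
Fact GL_mulrV : right_inverse GL_one GL_inv GL_mul.
Proof. by move=> x; apply: val_inj; rewrite /= mulmxV ?GL_unit. Qed.

HB.instance Definition _ :=
  isGroup.Build GL GL_mulA GL_mul1 GL_mulr1 GL_mulV GL_mulrV.

(* GL(n, S) for a subring S of R: the inverse must also have entries in S. *)
Definition GL_over (S : set R) : set GL :=
  [set g | (forall i j, S (GLmx g i j)) /\
           (forall i j, S (GLmx (g^-1)%g i j))].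

End GeneralLinear.

Section Arithmetic.
Variable R : realType.
Local Notation C := (complex R).

(* The variable of index mxvec_index i j is the (i, j) coordinate. *)
Definition zero_locus (n : nat) (P : set (mpoly.mpoly (n * n) rat)) :
    set (GL n C) :=
  [set g | forall p, P p ->
     mpoly.meval (fun k => mxvec (GLmx g) 0 k)
       (mpoly.map_mpoly (ratr : rat -> C) p) = 0].

Definition Q_defined_group (n : nat) (G : set (GL n C)) : Prop :=
  is_subgroup G /\ exists P, G = zero_locus P.

Definition Q_points (n : nat) (G : set (GL n C)) : set (GL n C) :=
  G `&` GL_over (range (ratr : rat -> C)).

Definition Z_points (n : nat) (G : set (GL n C)) : set (GL n C) :=
  G `&` GL_over (range (fun z : int => z%:~R : C)).

Definition arithmetic_subgroup (n : nat) (G Delta : set (GL n C)) : Prop :=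
  [/\ is_subgroup Delta,
      Delta `<=` Q_points G,
      finite_index (Delta `&` Z_points G) Delta &
      finite_index (Delta `&` Z_points G) (Z_points G)].

(* "The group H is arithmetic", for a subgroup H of an ambient group T. *)
Definition arithmetic_group (T : groupType) (H : set T) : Prop :=
  exists (n : nat) (G Delta : set (GL n C)),
    [/\ Q_defined_group G, arithmetic_subgroup G Delta & subgroup_iso H Delta].

End Arithmetic.

Section Automorphisms.
Variable G : groupType.

Record AutG := MkAut {
  aut_fun :> G -> G;
  aut_proof : `[< bijective aut_fun /\
                  {morph aut_fun : x y / (x * y)%g} >] }.

HB.instance Definition _ := [isSub for aut_fun].
HB.instance Definition _ := [Choice of AutG by <:].

Fact aut_one_proof : `[< bijective (@id G) /\ {morph @id G : x y / (x * y)%g} >].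
Proof. by apply/asboolP; split => //; exists id. Qed.

Fact aut_mul_proof (f g : AutG) :
  `[< bijective (f \o g) /\ {morph f \o g : x y / (x * y)%g} >].
Proof.
case: f g => [f /= /asboolP[bf mf]] [g /= /asboolP[bg mg]].
by apply/asboolP; split; [exact: bij_comp|move=> x y /=; rewrite mg mf].
Qed.

Fact aut_inv_ex (f : AutG) :
  {g : G -> G | cancel f g /\ cancel g f}.
Proof.
case: f => [f /= /asboolP[bf mf]].
by apply: cid; case: bf => g fg gf; exists g.
Qed.

Fact aut_inv_proof (f : AutG) :
  `[< bijective (sval (aut_inv_ex f)) /\
      {morph sval (aut_inv_ex f) : x y / (x * y)%g} >].
Proof.
case: (aut_inv_ex f) => g /= [fg gf]; apply/asboolP.
case: f fg gf => [f /= /asboolP[bf mf]] fg gf.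
split; first by exists f.
by move=> x y; apply: (bij_inj bf); rewrite mf !gf.
Qed.

Definition aut_one := MkAut aut_one_proof.
Definition aut_mul (f g : AutG) := MkAut (aut_mul_proof f g).
Definition aut_inv (f : AutG) := MkAut (aut_inv_proof f).

Fact aut_mulA : associative aut_mul.
Proof. by move=> f g h; apply: val_inj. Qed.
Fact aut_mul1 : left_id aut_one aut_mul.
Proof. by move=> f; apply: val_inj. Qed.
Fact aut_mulr1 : right_id aut_one aut_mul.
Proof. by move=> f; apply: val_inj. Qed.
Fact aut_mulV : left_inverse aut_one aut_inv aut_mul.
Proof.
move=> f; apply: val_inj; apply: funext => x /=.
by case: (aut_inv_ex f) => g [].
Qed.
Fact aut_mulrV : right_inverse aut_one aut_inv aut_mul.
Proof.
move=> f; apply: val_inj; apply: funext => x /=.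
by case: (aut_inv_ex f) => g [].
Qed.

HB.instance Definition _ :=
  isGroup.Build AutG aut_mulA aut_mul1 aut_mulr1 aut_mulV aut_mulrV.

End Automorphisms.

Record group_action (D : groupType) (F : zmodType) := GroupAction {
  act_fun :> D -> F -> F;
  act_one : forall u, act_fun 1%g u = u;
  act_mul : forall x y u, act_fun (x * y)%g u = act_fun x (act_fun y u);
  act_add : forall x, {morph act_fun x : u v / u + v} }.

Section SemidirectProduct.
Variables (D : groupType) (F : zmodType) (act : group_action D F).

Definition semidirect of group_action D F : Type := (F * D)%type.
Local Notation S := (semidirect act).

HB.instance Definition _ := Choice.on S.

(* (u, x) stands for the product u x, with x u x^-1 = act x u. *)
Definition sd_one : S := (0, 1%g).
Definition sd_mul (g h : S) : S := (g.1 + act g.2 h.1, (g.2 * h.2)%g).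
Definition sd_inv (g : S) : S := (- act (g.2^-1)%g g.1, (g.2^-1)%g).

Fact act_zero x : act x 0 = 0.
Proof. by apply: (addrI (act x 0)); rewrite -act_add !addr0. Qed.
Fact act_opp x u : act x (- u) = - act x u.
Proof. by apply/eqP; rewrite -addr_eq0 -act_add addNr act_zero. Qed.

Fact sd_mulA : associative sd_mul.
Proof. by move=> g h k; rewrite /sd_mul /= act_add act_mul addrA mulgA. Qed.
Fact sd_mul1 : left_id sd_one sd_mul.
Proof. by case=> u x; rewrite /sd_mul /= act_one add0r mul1g. Qed.
Fact sd_mulr1 : right_id sd_one sd_mul.
Proof. by case=> u x; rewrite /sd_mul /= act_zero addr0 mulg1. Qed.
Fact sd_mulV : left_inverse sd_one sd_inv sd_mul.
Proof. by case=> u x; rewrite /sd_mul /= addNr mulVg. Qed.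
Fact sd_mulrV : right_inverse sd_one sd_inv sd_mul.
Proof.
by case=> u x; rewrite /sd_mul /= act_opp -act_mul mulgV act_one addrN.
Qed.

HB.instance Definition _ :=
  isGroup.Build S sd_mulA sd_mul1 sd_mulr1 sd_mulV sd_mulrV.

End SemidirectProduct.

(* D = < A, tau | tau^2 = (A tau)^2 = 1 >, by the universal property of
   a presentation. *)
Definition infinite_dihedral (D : groupType) (A tau : D) : Prop :=
  [/\ (tau ^+ 2 = 1)%g, ((A * tau) ^+ 2 = 1)%g &
      forall (H : groupType) (a t : H),
        (t ^+ 2 = 1)%g -> ((a * t) ^+ 2 = 1)%g ->
        exists f : {multiplicative D -> H},
          [/\ f A = a, f tau = t &
              forall g : {multiplicative D -> H},
                g A = a -> g tau = t -> g =1 f]].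

Section QuadraticOrder.
Variables (K : fieldType) (s : K).

(* The order Z + Z s; only its additive structure is registered, products are
   taken in K. *)
Definition in_order : {pred K} :=
  [pred x | `[< exists a b : int, x = a%:~R + b%:~R * s >]].

Record quad_order := MkQuadOrder { qo_val :> K; qo_valP : qo_val \in in_order }.

HB.instance Definition _ := [isSub for qo_val].
HB.instance Definition _ := [Choice of quad_order by <:].

Fact in_order_zmod : zmod_closed in_order.
Proof.
split=> [|x y /asboolP[a [b ->]] /asboolP[c [e ->]]]; apply/asboolP.
  by exists 0, 0; rewrite mul0r addr0.
by exists (a - c), (b - e); rewrite !rmorphB mulrBl opprD addrACA.
Qed.

HB.instance Definition _ :=
  GRing.isZmodClosed.Build K in_order in_order_zmod.
HB.instance Definition _ := [SubChoice_isSubZmodule of quad_order by <:].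

End QuadraticOrder.

(* Main.v *)
Require Import Defs.
From HB Require Import structures.
From mathcomp Require Import all_boot all_order all_fingroup all_algebra all_field.
From mathcomp Require Import boolp classical_sets functions cardinality reals.
From mathcomp Require Import complex.
From mathcomp Require mpoly.
From mathcomp Require Import ring zify.

Set Implicit Arguments.
Unset Strict Implicit.
Unset Printing Implicit Defensive.

Import GRing.Theory Order.TTheory Num.Theory.

Local Open Scope classical_set_scope.
Local Open Scope ring_scope.

(** Why the theorem holds.  Write [a] for conjugation by a power of [A], and let
    [th] be the shear of [Gamma] that fixes [F] and [tau] pointwise and sends
    [A] to [(0, 1) A].  Inside [Aut Gamma] the elements [a], a power of [th], and
    the conjugation [z] by a multiple of [(0, 1)] generate a Heisenberg group: [z]
    is the commutator of [th] and [a], and is central there.  At the same time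
    [a] acts on the conjugations by elements of [O] through a power of [eps],
    which is hyperbolic.  So [a] is neither semisimple nor unipotent, and an
    arithmetic group would have to contain the two parts of [a] separately,
    whereas no automorphism of [Gamma] is a unipotent part of [a].

    On the algebraic side ([arithmetic_unipotent_part]), let [a = s u] be the
    multiplicative Jordan decomposition of an element of an arithmetic subgroup
    [Delta] of [G].  The matrices [s] and [u] are rational ([jordan_chevalley]).
    A polynomial that vanishes on all powers of [a] vanishes on all powers of [u]
    ([unipotent_part_zero]), hence the powers of [u] lie in [G].  Some power of
    [u] is integral ([unipotent_exp_int]), so a further power [v] lies in
    [Delta].  The element [v] commutes with all that commutes with [a] in
    [Delta].  It has two more properties, stated without reference to matrices.
    First, [v] cannot act hyperbolically on a commutative group: a relation
    [b2 b0 = b1 ^ T] with [T > 2] between the successive conjugates of [b] by a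
    power of [v] forces [b] to have finite order ([unipotent_conj_recurrence]).
    Second, if [t a t^-1 = z a], where [z] commutes with [a] and [t], and a
    positive power of [v] commutes with [t], then [z] has finite order: in that
    case the semisimple factor absorbs all of [z] ([commutator_finite_order]).

    On the group side, let [w] be the automorphism of [Gamma] that corresponds
    to [v].  It commutes with [a], hence fixes a power of [A].  This forces [w] to
    act on [O] as multiplication by a unit [l] and on [Z] by a sign, and to send
    [tau] to some [v' A^j tau] with [eps^j bar(l) = l].  As [l bar(l)] is a sign,
    [w^4] acts on [F] exactly as [A^(2j)] ([aut4_on_F]).  If [j] is not zero, then
    [w^4] acts on [O] as a power of [eps] of trace [T > 2], against the first
    property.  If [j = 0], then [w^4] fixes [F] and [A] and moves [tau] only by
    an element of [F], so it commutes with [th]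
    ([trivial_on_F_comm_shear]); the second property says that [z] has finite
    order, which it has not, since the centre of [Gamma] is trivial and [F] has
    no torsion. *)

(** * Jordan decomposition of a rational matrix *)

Definition squarefree_part (F : fieldType) (p : {poly F}) := p %/ gcdp p p^`().

(** In characteristic zero a root of multiplicity [e > 0] has multiplicity
    [e - 1] in the derivative, so exactly one factor survives the quotient. *)
Lemma root_squarefree_part (C : numFieldType) (p : {poly C}) x :
  p != 0 -> root p x -> root (squarefree_part p) x.
Proof.
move=> p0 px; apply/negPn/negP => rx.
have [e [q qx pE]] :
    exists e, exists2 q, ~~ root q x & p = q * ('X - x%:P) ^+ e.+1.
  have [[|e] [q]] := multiplicity_XsubC p x.
    by rewrite p0 /= expr0 mulr1 => qx pq; move: px; rewrite pq (negPf qx).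
  by rewrite p0 /= => qx pE; exists e, q.
have cop : coprimep (('X - x%:P) ^+ e.+1) (squarefree_part p).
  by rewrite coprimep_expl // coprimep_sym coprimep_XsubC.
have dvg : ('X - x%:P) ^+ e.+1 %| gcdp p p^`().
  by rewrite -(Gauss_dvdpr _ cop) divpK ?dvdp_gcdl // pE dvdp_mull.
have : ('X - x%:P) ^+ e.+1 %| p^`() by apply: dvdp_trans dvg (dvdp_gcdr _ _).
rewrite pE derivM deriv_exp derivXsubC mul1r /=.
rewrite (dvdp_addr _ (dvdp_mull _ (dvdpp _))).
rewrite -mulr_natl mulrCA exprS mulrA.
rewrite dvdp_mul2r ?expf_neq0 ?polyXsubC_eq0 // dvdp_XsubCl.
by rewrite rootM (negPf qx) -polyC_natr rootC pnatr_eq0.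
Qed.

Lemma dvdp_squarefree_part_exp (C : numClosedFieldType) (p : {poly C}) :
  p != 0 -> exists m, p %| squarefree_part p ^+ m.
Proof.
move=> p0; have [rs pE] := closed_field_poly_normal p.
exists (size rs); rewrite {1}pE dvdpZl ?lead_coef_eq0 //.
have : all (root p) rs.
  by apply/allP => x xrs; rewrite pE rootZ ?lead_coef_eq0 // root_prod_XsubC.
elim: rs {pE} => [|x rs IH] /=; first by rewrite big_nil dvd1p.
case/andP=> px prs; rewrite big_cons exprS dvdp_mul ?IH //.
by rewrite dvdp_XsubCl root_squarefree_part.
Qed.

Lemma map_squarefree_part (F G : fieldType) (f : {rmorphism F -> G}) p :
  map_poly f (squarefree_part p) = squarefree_part (map_poly f p).
Proof. by rewrite /squarefree_part map_divp gcdp_map deriv_map. Qed.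

(** Divisibility is insensitive to field extension, so it may be tested over the
    algebraic numbers, where roots decide it. *)
Lemma dvdp_squarefree_part_exp_rat (p : {poly rat}) :
  p != 0 -> exists m, p %| squarefree_part p ^+ m.
Proof.
move=> p0; have [|m] := @dvdp_squarefree_part_exp algC (map_poly ratr p).
  by rewrite map_poly_eq0.
rewrite -map_squarefree_part -rmorphXn /= dvdp_map => pm; by exists m.
Qed.

Lemma taylor1 (R : comNzRingType) (p h : {poly R}) :
  exists c, p \Po ('X + h) = p + p^`() * h + c * h ^+ 2.
Proof.
elim/poly_ind: p => [|p a [c IH]].
  by exists 0; rewrite comp_poly0 deriv0 !mul0r !addr0.
rewrite comp_poly_MXaddC IH derivD derivM derivX derivC.
exists (p^`() + c * 'X + c * h); ring.
Qed.

(** Newton's iteration [X - r / r'] in the [r]-adic topology: [r'] is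
    invertible modulo [r] by separability, and the substitution makes [r] vanish
    to the second order, hence doubles any order of vanishing. *)
Lemma newton_lift (F : fieldType) (r : {poly F}) k :
  separable_poly r -> exists q, (r ^+ k.+1 %| r \Po q) && (r %| q - 'X).
Proof.
move=> sep; elim: k => [|k [q /andP[rq qX]]].
  by exists 'X; rewrite expr1 comp_polyXr dvdpp subrr dvdp0.
have := sep; rewrite unlock => /Bezout_eq1_coprimepP[[h g] /= hg].
have [c yE] := taylor1 r (- (r * g)).
set y := 'X + _ in yE.
have ry : r ^+ 2 %| r \Po y.
  rewrite yE.
  have -> : r + r^`() * - (r * g) + c * (- (r * g)) ^+ 2
      = r ^+ 2 * (h + c * g ^+ 2).
    have e : 1 - r^`() * g = h * r by rewrite -hg; ring.
    transitivity (r * (1 - r^`() * g) + c * (r * g) ^+ 2); first by ring.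
    by rewrite e; ring.
  by rewrite dvdp_mulr.
exists (q \Po y); rewrite comp_polyA; apply/andP; split.
  case/dvdpP: rq => w ->; rewrite comp_polyM rmorphXn /= dvdp_mull //.
  apply: dvdp_trans (dvdp_exp2r k.+1 ry).
  by rewrite -exprM dvdp_exp2l //; lia.
have -> : (q \Po y) - 'X = ((q - 'X) \Po y) + (y - 'X).
  by rewrite comp_polyB comp_polyX addrA subrK.
rewrite dvdp_add //.
  case/dvdpP: qX => w ->; rewrite comp_polyM dvdp_mull //.
  by apply: dvdp_trans ry; rewrite -[X in X %| _]expr1 dvdp_exp2l.
by rewrite /y addrC addKr dvdpNr dvdp_mulr.
Qed.

Lemma horner_mx_comp (R : comNzRingType) n (A : 'M[R]_n.+1) (p q : {poly R}) :
  horner_mx A (p \Po q) = horner_mx (horner_mx A q) p.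
Proof.
elim/poly_ind: p => [|p c IH]; first by rewrite comp_poly0 !rmorph0.
rewrite comp_poly_MXaddC [LHS]rmorphD [RHS]rmorphD /= !rmorphM /= IH.
by rewrite horner_mx_X !horner_mx_C.
Qed.

(** [x ^ m - (x - y) ^ m] is divisible by [y] when [x] and [y] commute. *)
Lemma unitr_comm_nilp (R : unitRingType) (x y : R) m :
  x \is a GRing.unit -> GRing.comm x y -> (x - y) ^+ m = 0 ->
  y \is a GRing.unit.
Proof.
move=> xu xy nil; have cx : GRing.comm x (x - y) by apply: commrB.
have e : x ^+ m = y * \sum_(i < m) x ^+ (m.-1 - i) * (x - y) ^+ i.
  have := @subrXX_comm _ x (x - y) m cx; rewrite nil subr0 => ->.
  by rewrite opprB addrC subrK.
have cy : GRing.comm y (\sum_(i < m) x ^+ (m.-1 - i) * (x - y) ^+ i).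
  apply: commr_sum => i _; apply: commrM; apply: commrX; first exact: commr_sym.
  by apply: commrB; [exact: commr_sym|exact: commr_refl].
have : x ^+ m \is a GRing.unit by rewrite unitrX.
by rewrite e unitrM_comm // => /andP[].
Qed.

(** The semisimple part is the root of the squarefree part of the
    characteristic polynomial that Newton's iteration finds near [a].  Being a
    polynomial in [a] with rational coefficients, it is rational and commutes
    with the centraliser of [a]. *)
Theorem jordan_chevalley n (a : 'M[rat]_n.+1) : a \is a GRing.unit ->
  exists s u : 'M[rat]_n.+1,
    [/\ a = s * u, s \is a GRing.unit,
        exists m, (u - 1) ^+ m = 0,
        exists2 r, separable_poly r & horner_mx s r = 0 &
        forall b, GRing.comm a b -> GRing.comm s b].
Proof.
move=> au; set p := char_poly a.
have p0 : p != 0 by rewrite monic_neq0 ?char_poly_monic.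
set r := squarefree_part p; have sep : separable_poly r by apply: make_separable.
have [m pr] := dvdp_squarefree_part_exp_rat p0; rewrite -/r in pr.
have [q /andP[rq qX]] := newton_lift m sep.
have ra q' : r ^+ m %| q' -> horner_mx a q' = 0.
  move=> h; have /dvdpP[w ->] := dvdp_trans pr h.
  by rewrite rmorphM /= Cayley_Hamilton mulr0.
set s := horner_mx a q.
have com b : GRing.comm a b -> GRing.comm s b.
  by move=> ab; apply: commr_sym; apply: comm_mx_horner; apply: commr_sym.
have nil : (a - s) ^+ m = 0.
  have -> : a - s = - horner_mx a (q - 'X).
    by rewrite rmorphB /= horner_mx_X opprB.
  by rewrite exprNn -rmorphXn /= ra ?mulr0 // dvdp_exp2r.
have sa : GRing.comm s a by apply: com; apply: commr_refl.
have su : s \is a GRing.unit.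
  by apply: unitr_comm_nilp nil => //; apply: commr_sym.
exists s, (s^-1 * a); split => //.
- by rewrite mulrA divrr // mul1r.
- exists m; have -> : s^-1 * a - 1 = s^-1 * (a - s) by rewrite mulrBr mulVr.
  rewrite exprMn_comm ?nil ?mulr0 //.
  by apply: commrB; apply: commr_sym; apply: commrV => //; apply: commr_sym.
- exists r => //; rewrite -horner_mx_comp ra //.
  by apply: dvdp_trans rq; rewrite dvdp_exp2l.
Qed.

Lemma separable_diagonalizable (C : numClosedFieldType) n
    (s : 'M[rat]_n.+1) r : separable_poly r -> horner_mx s r = 0 ->
  exists2 P : 'M[C]_n.+1, P \in unitmx &
    exists d, P *m map_mx ratr s *m invmx P = diag_mx d.
Proof.
move=> sep sr.
have r0 : map_poly (ratr : rat -> C) r != 0.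
  rewrite map_poly_eq0; apply: contraTneq sep => ->.
  by rewrite unlock deriv0 /coprimep gcd0p size_poly0.
have [rs rE] := closed_field_poly_normal (map_poly (ratr : rat -> C) r).
have urs : uniq rs.
  rewrite -separable_prod_XsubC.
  rewrite -(@eqp_separable _ (map_poly (ratr : rat -> C) r)).
    by rewrite separable_map.
  by rewrite [X in X %= _]rE eqp_scale ?lead_coef_eq0.
have : diagonalizable (map_mx (ratr : rat -> C) s).
  apply/diagonalizableP; exists rs => //.
  rewrite -(dvdpZr _ _ (_ : lead_coef (map_poly (ratr : rat -> C) r) != 0));
    last by rewrite lead_coef_eq0.
  by rewrite -rE; apply: mxminpoly_min; rewrite -map_horner_mx sr map_mx0.
case=> P Pu /diagonalizable_forPex[d /(simmxRL Pu)]; exists P => //; by exists d.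
Qed.

(** * Exponential polynomials *)

Lemma ltn_size_subr (R : nzRingType) (p q : {poly R}) :
  p != 0 -> size q = size p -> lead_coef q = lead_coef p ->
  (size (q - p)%R < size p)%N.
Proof.
move=> p0 szE lcE; rewrite (polySpred p0) ltnS; apply/leq_sizeP => j.
rewrite leq_eqVlt => /predU1P[<-|hj]; rewrite coefB.
  by move: lcE; rewrite !lead_coefE szE => ->; rewrite subrr.
have hp : (size p <= j)%N by move: hj; rewrite -(polySpred p0).
by rewrite !nth_default ?szE // subrr.
Qed.

Section ExpPoly.
Variable C : numFieldType.
Implicit Types (p q : {poly C}) (f g : nat -> C) (h : nat -> nat -> C).

Definition shift p := p \Po ('X + 1%:P).

Lemma shiftE p m : (shift p).[m%:R] = p.[m.+1%:R].
Proof. by rewrite horner_comp !hornerE -natr1. Qed.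

Lemma size_shift p : size (shift p) = size p.
Proof. by rewrite size_comp_poly2 // size_XaddC. Qed.

Lemma lead_coef_shift p : lead_coef (shift p) = lead_coef p.
Proof. by rewrite lead_coef_comp ?size_XaddC // lead_coefXaddC expr1n mulr1. Qed.

Lemma poly_nat_eq0 p : (forall m : nat, p.[m%:R] = 0) -> p = 0.
Proof.
move=> p0; apply/eqP/negPn/negP => nz.
have := @max_poly_roots _ p [seq m%:R | m <- iota 0 (size p)] nz.
rewrite size_map size_iota ltnn => H; suff: false by [].
apply: H; first by apply/allP => _ /mapP[m _ ->]; apply/eqP.
by rewrite map_inj_uniq ?iota_uniq // => a b /eqP; rewrite eqr_nat => /eqP.
Qed.

(** The functions [m |-> x ^ m * m ^ i] are linearly independent.  The operator
    that sends [y] to [y(m + 1) - x0 y(m)] lowers the degree of the polynomial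
    attached to [x0] and preserves the leading coefficients of the others up to
    the nonzero factors [x - x0]. *)
Lemma exp_poly_indep (rs : seq C) (P : C -> {poly C}) :
  uniq rs -> 0 \notin rs ->
  (forall m : nat, \sum_(x <- rs) x ^+ m * (P x).[m%:R] = 0) ->
  {in rs, forall x, P x = 0}.
Proof.
elim: rs P => [|x0 rs IH] P //= /andP[x0rs urs].
rewrite inE negb_or eq_sym => /andP[x00 rs0].
have [k] := ubnP (size (P x0)); elim: k => // k IHk in P * => szP sumP.
have [P0|P0] := eqVneq (P x0) 0.
  have H := IH P urs rs0.
  move=> x; rewrite inE => /predU1P[->//|]; apply: H => m.
  by have := sumP m; rewrite big_cons P0 horner0 mulr0 add0r.
pose Q x := x *: shift (P x) - x0 *: P x.
have Q0 : {in x0 :: rs, forall x, Q x = 0}.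
  apply: IHk.
    rewrite /Q -scalerBr (leq_ltn_trans (size_scale_leq _ _)) //.
    by apply: leq_trans (ltn_size_subr P0 (size_shift _) (lead_coef_shift _)) _.
  move=> m; transitivity (\sum_(x <- x0 :: rs) x ^+ m.+1 * (P x).[m.+1%:R]
    - x0 * \sum_(x <- x0 :: rs) x ^+ m * (P x).[m%:R]).
    rewrite mulr_sumr -sumrB; apply: eq_bigr => x _.
    by rewrite /Q hornerD hornerN !hornerZ shiftE exprS; ring.
  by rewrite !sumP mulr0 subrr.
have Prs : {in rs, forall x, P x = 0}.
  move=> x xrs; have xin : x \in x0 :: rs by rewrite inE xrs orbT.
  have /eqP := Q0 x xin; rewrite subr_eq0 => /eqP/(congr1 lead_coef).
  rewrite !lead_coefZ lead_coef_shift => /eqP.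
  rewrite -subr_eq0 -mulrBl mulf_eq0 lead_coef_eq0 subr_eq0.
  case/orP => [/eqP xx0|/eqP//].
  by rewrite -xx0 xrs in x0rs.
case/negP: P0; apply/eqP/poly_nat_eq0 => m.
have := sumP m; rewrite big_cons big_seq big1 ?addr0.
  by move/eqP; rewrite mulf_eq0 expf_eq0 (negPf x00) andbF /= => /eqP.
by move=> x xrs; rewrite Prs // horner0 mulr0.
Qed.

Definition poly_seq f := exists p, forall i, f i = p.[i%:R].

Lemma poly_seq_cst c : poly_seq (fun=> c).
Proof. by exists c%:P => i; rewrite hornerC. Qed.

Lemma poly_seqM f g : poly_seq f -> poly_seq g -> poly_seq (fun i => f i * g i).
Proof. by move=> [p fE] [q gE]; exists (p * q) => i; rewrite hornerM fE gE. Qed.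

Lemma poly_seq_sum (I : Type) (r : seq I) (F : I -> nat -> C) :
  (forall x, poly_seq (F x)) -> poly_seq (fun i => \sum_(x <- r) F x i).
Proof.
move=> HF; elim: r => [|x r [p IH]].
  by exists 0 => i; rewrite big_nil horner0.
have [q qE] := HF x; exists (q + p) => i.
by rewrite big_cons hornerD qE IH.
Qed.

Lemma poly_seq_bin k : poly_seq (fun i => 'C(i, k)%:R).
Proof.
have [p pE] : poly_seq (fun i => (i ^_ k)%:R).
  elim: k => [|k [p IH]]; first by exists 1 => i; rewrite ffactn0 hornerE.
  exists (p * ('X - k%:R%:P)) => i; rewrite ffactnSr natrM hornerM -IH !hornerE.
  have [ik|ki] := ltnP i k; first by rewrite ffact_small // !mul0r.
  by rewrite natrB.
exists ((k`!%:R)^-1 *: p) => i; rewrite hornerZ -pE -bin_ffact natrM mulrC mulfK //.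
by rewrite pnatr_eq0 -lt0n fact_gt0.
Qed.

(** The exponent [m] and the polynomial argument [j] are kept apart, since the
    point is to deduce the vanishing at all [(m, j)] from that on the diagonal.
    The bases are nonzero because [m = 0] has to be determined by the rest. *)
Definition exp_poly h := exists l : seq (C * {poly C}),
  all (fun x => x.1 != 0) l /\
  forall m j : nat, h m j = \sum_(x <- l) x.1 ^+ m * x.2.[j%:R].

Lemma exp_poly_seq f : poly_seq f -> exp_poly (fun _ j => f j).
Proof.
case=> p fE; exists [:: (1, p)]; split=> [|m j]; first by rewrite /= oner_eq0.
by rewrite big_seq1 expr1n mul1r fE.
Qed.

Lemma exp_poly_exp x : x != 0 -> exp_poly (fun m _ => x ^+ m).
Proof.
move=> x0; exists [:: (x, 1)]; split=> [|m j]; first by rewrite /= x0.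
by rewrite big_seq1 hornerC mulr1.
Qed.

Lemma exp_poly_cst c : exp_poly (fun _ _ => c).
Proof. exact/exp_poly_seq/poly_seq_cst. Qed.

Lemma exp_polyD h (k : nat -> nat -> C) :
  exp_poly h -> exp_poly k -> exp_poly (fun m j => h m j + k m j).
Proof.
move=> [l [l0 hE]] [l' [l0' kE]]; exists (l ++ l').
by rewrite all_cat l0 l0'; split=> // m j; rewrite big_cat hE kE.
Qed.

Lemma exp_polyM h (k : nat -> nat -> C) :
  exp_poly h -> exp_poly k -> exp_poly (fun m j => h m j * k m j).
Proof.
move=> [l [l0 hE]] [l' [l0' kE]].
exists [seq (x.1 * y.1, x.2 * y.2) | x <- l, y <- l']; split.
  apply/allP => z /allpairsP[[x y] [xl yl ->]] /=.
  exact: mulf_neq0 (allP l0 _ xl) (allP l0' _ yl).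
move=> m j; rewrite hE kE big_allpairs_dep mulr_suml; apply: eq_bigr => x _ /=.
rewrite mulr_sumr; apply: eq_bigr => y _ /=.
by rewrite exprMn hornerM; ring.
Qed.

Lemma exp_poly_sum (I : Type) (r : seq I) (F : I -> nat -> nat -> C) :
  (forall x, exp_poly (F x)) -> exp_poly (fun m j => \sum_(x <- r) F x m j).
Proof.
move=> HF; elim: r => [|x r IH].
  by exists [::]; split=> // m j; rewrite !big_nil.
have [l [l0 lE]] := exp_polyD (HF x) IH.
by exists l; split=> // m j; rewrite big_cons lE.
Qed.

Lemma exp_poly_prod (I : Type) (r : seq I) (F : I -> nat -> nat -> C) :
  (forall x, exp_poly (F x)) -> exp_poly (fun m j => \prod_(x <- r) F x m j).
Proof.
move=> HF; elim: r => [|x r IH].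
  have [l [l0 lE]] := exp_poly_cst 1.
  by exists l; split=> // m j; rewrite !big_nil.
have [l [l0 lE]] := exp_polyM (HF x) IH.
by exists l; split=> // m j; rewrite big_cons lE.
Qed.

Lemma exp_poly_pow h e : exp_poly h -> exp_poly (fun m j => h m j ^+ e).
Proof.
move=> hE; have [l [l0 lE]] := exp_poly_prod (index_enum 'I_e) (fun=> hE).
exists l; split=> // m j.
by rewrite -lE prodr_const card_ord.
Qed.

(** Grouping equal bases turns the values on the diagonal into a combination to
    which [exp_poly_indep] applies, so that all coefficients vanish. *)
Theorem exp_poly_diag h :
  exp_poly h -> (forall m, h m m = 0) -> forall m j, h m j = 0.
Proof.
case=> l [l0 hE] h0.
pose rs := undup [seq x.1 | x <- l].
pose P x := \sum_(y <- l | y.1 == x) y.2.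
have hE' m j : h m j = \sum_(x <- rs) x ^+ m * (P x).[j%:R].
  rewrite hE.
  under [RHS]eq_bigr => x _ do rewrite /P horner_sum mulr_sumr.
  rewrite (exchange_big_dep xpredT) //=.
  rewrite big_seq [RHS]big_seq; apply: eq_bigr => y yl.
  rewrite big_mkcond (bigD1_seq y.1) ?undup_uniq ?mem_undup ?map_f //=.
  by rewrite eqxx big1 ?addr0 // => x /negPf; rewrite eq_sym => ->.
have P0 : {in rs, forall x, P x = 0}.
  apply: exp_poly_indep; first exact: undup_uniq.
    rewrite mem_undup; apply/mapP => -[x xl x0].
    by have := allP l0 x xl; rewrite -x0 eqxx.
  by move=> m; rewrite -hE'.
by move=> m j; rewrite hE' big_seq big1 // => x xrs; rewrite P0 // horner0 mulr0.
Qed.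

End ExpPoly.

(** * Powers of unipotent and semisimple matrices *)

(** The number of terms is the nilpotency index [k], whatever [j] is: this makes
    the entries of [u ^ j] polynomials in [j]. *)
Lemma unipotent_exp (R : nzRingType) (u : R) k j : (u - 1) ^+ k = 0 ->
  u ^+ j = \sum_(i < k) (u - 1) ^+ i *+ 'C(j, i).
Proof.
move=> nil; have big0 i : (k <= i)%N -> (u - 1) ^+ i = 0.
  by move=> ki; rewrite -(subnK ki) exprD nil mulr0.
rewrite -{1}(subrK 1 u) addrC exprDn_comm; last exact/commr_sym/commr1.
under eq_bigr => i _ do rewrite expr1n mul1r.
rewrite -!(big_mkord xpredT (fun i => (u - 1) ^+ i *+ 'C(j, i))).
have e1 m M : (m <= M)%N ->
  (forall i, (m <= i)%N -> (u - 1) ^+ i *+ 'C(j, i) = 0) ->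
  \sum_(0 <= i < m) (u - 1) ^+ i *+ 'C(j, i)
    = \sum_(0 <= i < M) (u - 1) ^+ i *+ 'C(j, i).
  move=> mM H; rewrite [RHS](@big_cat_nat _ _ _ m) //=.
  rewrite -[LHS]addr0; congr (_ + _).
  by rewrite big_nat_cond big1 // => i /andP[/andP[/H]].
rewrite (e1 j.+1 (j.+1 + k)%N) ?leq_addr //; last first.
  by move=> i ji; rewrite bin_small ?mulr0n.
rewrite (e1 k (j.+1 + k)%N) ?leq_addl // => i ki.
by rewrite big0 // mul0rn.
Qed.

Lemma unipotent_inv (R : unitRingType) (u : R) k :
  u \is a GRing.unit -> (u - 1) ^+ k = 0 -> (u^-1 - 1) ^+ k = 0.
Proof.
move=> uu nil; have -> : u^-1 - 1 = - u^-1 * (u - 1).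
  by rewrite mulNr mulrBr mulVr // mulr1 opprB.
rewrite exprMn_comm ?nil ?mulr0 //.
apply: commrB; last exact: commr1.
by apply: commr_sym; apply: commrN; apply: commrV; exact: commr_refl.
Qed.

Lemma common_denominator (I : finType) (F : I -> rat) :
  exists2 D : nat, (0 < D)%N & forall x, D%:R * F x \is a Num.int.
Proof.
exists (\prod_x `|denq (F x)|%N).
  by rewrite prodn_gt0 // => x; rewrite absz_gt0 denq_neq0.
move=> x; rewrite (bigD1 x) //= natrM mulrAC rpredM ?rpred_nat //.
rewrite pmulrn gez0_abs ?denq_ge0 // mulrC -numqE.
exact: intr_int.
Qed.

(** With [D] a common denominator of the powers of [u - 1], it suffices that [D]
    divides the binomial coefficients ['C(M, i)] for [0 < i < k]; by
    [i 'C(M, i) = M 'C(M - 1, i - 1)] this holds as soon as [D k!] divides [M]. *)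
Lemma unipotent_exp_int n (u : 'M[rat]_n.+1) k : (u - 1) ^+ k = 0 ->
  exists2 N : nat, (0 < N)%N &
    forall M, (N %| M)%N -> forall p q, (u ^+ M) p q \is a Num.int.
Proof.
move=> nil.
have [D D0 DP] := @common_denominator ('I_k * ('I_n.+1 * 'I_n.+1))%type
  (fun x => ((u - 1) ^+ x.1) x.2.1 x.2.2).
exists (D * k`!)%N; first by rewrite muln_gt0 D0 fact_gt0.
move=> M /dvdnP[c ME] p q; rewrite (unipotent_exp _ nil) summxE rpred_sum // => i _.
rewrite mulmxnE.
have [i0|i0] := posnP i; first by rewrite i0 bin0 expr0 mulr1n mxE rpred_nat.
have /dvdnP[f fE] : (i %| k`!)%N by apply: dvdn_fact; rewrite i0 ltnW.
have : (i * 'C(M, i) = i * (c * D * f * 'C(M.-1, i.-1)))%N.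
  by have := mul_bin_diag M i.-1; rewrite prednK // => <-; rewrite {1}ME fE; lia.
move/eqP; rewrite eqn_pmul2l // => /eqP ->.
rewrite -mulr_natl !natrM.
rewrite (_ : _ * _ = c%:R * f%:R * 'C(M.-1, i.-1)%:R * (D%:R * ((u - 1) ^+ i) p q)).
  by rewrite rpredM ?(DP (i, (p, q))) // !rpredM // rpred_nat.
by ring.
Qed.

Lemma diag_mx_exp (R : nzRingType) n (d : 'rV[R]_n.+1) m :
  diag_mx d ^+ m = diag_mx (\row_k d 0 k ^+ m).
Proof.
elim: m => [|m IH]; first by apply/matrixP => p q; rewrite !mxE.
rewrite exprS IH; apply/matrixP => p q.
have -> : diag_mx d * diag_mx (\row_k d 0 k ^+ m) =
  diag_mx d *m diag_mx (\row_k d 0 k ^+ m) by [].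
by rewrite mul_diag_mx !mxE exprS mulrnAr.
Qed.

Lemma conj_diag_exp (R : unitRingType) (x P D : R) m : P \is a GRing.unit ->
  P * x * P^-1 = D -> x ^+ m = P^-1 * D ^+ m * P.
Proof.
move=> Pu dE; have sd : x = P^-1 * D * P by rewrite -dE !mulrA mulVr // mul1r mulrVK.
elim: m => [|m IH]; first by rewrite !expr0 mulr1 mulVr.
by rewrite exprS IH {1}sd exprS !mulrA mulrK.
Qed.

Section MatrixSequences.
Variables (C : numFieldType) (n : nat).
Implicit Types (F G : nat -> 'M[C]_n.+1) (H K : nat -> nat -> 'M[C]_n.+1).

Definition mx_poly_seq F := forall p q, poly_seq (fun i => F i p q).

Lemma mx_poly_seq_cst A : mx_poly_seq (fun=> A).
Proof. by move=> p q; apply: poly_seq_cst. Qed.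

Lemma mx_poly_seqM F G :
  mx_poly_seq F -> mx_poly_seq G -> mx_poly_seq (fun i => F i * G i).
Proof.
move=> hF hG p q.
have [P PE] := poly_seq_sum (index_enum 'I_n.+1)
  (fun r => poly_seqM (hF p r) (hG r q)).
by exists P => i; rewrite -PE mxE.
Qed.

Lemma mx_poly_seqX F e : mx_poly_seq F -> mx_poly_seq (fun i => F i ^+ e).
Proof.
move=> hF; elim: e => [|e IH] p q.
  by apply: poly_seq_cst.
have [P PE] := mx_poly_seqM hF IH p q.
by exists P => i; rewrite exprS PE.
Qed.

Lemma mx_poly_seq_unipotent (u : 'M[C]_n.+1) k :
  (u - 1) ^+ k = 0 -> mx_poly_seq (fun i => u ^+ i).
Proof.
move=> nil p q.
have [P PE] := poly_seq_sum (index_enum 'I_k)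
  (fun i => poly_seqM (poly_seq_cst (((u - 1) ^+ i) p q)) (poly_seq_bin C i)).
exists P => j; rewrite -PE (unipotent_exp _ nil) summxE.
by apply: eq_bigr => i _; rewrite mulmxnE mulr_natr.
Qed.

Definition mx_exp_poly H := forall p q, exp_poly (fun m j => H m j p q).

Lemma mx_exp_poly_seq F : mx_poly_seq F -> mx_exp_poly (fun _ j => F j).
Proof. by move=> hF p q; apply: exp_poly_seq. Qed.

Lemma mx_exp_polyM H K :
  mx_exp_poly H -> mx_exp_poly K -> mx_exp_poly (fun m j => H m j * K m j).
Proof.
move=> hH hK p q.
have [l [l0 lE]] := exp_poly_sum (index_enum 'I_n.+1)
  (fun r => exp_polyM (hH p r) (hK r q)).
by exists l; split=> // m j; rewrite -lE mxE.
Qed.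

Lemma mx_exp_poly_diagonalizable (s P : 'M[C]_n.+1) d :
  P \is a GRing.unit -> s \is a GRing.unit -> P * s * P^-1 = diag_mx d ->
  mx_exp_poly (fun m _ => s ^+ m).
Proof.
move=> Pu su dE.
have d0 i : d 0 i != 0.
  have : P * s * P^-1 \in unitmx.
    by rewrite -[_ \in _]/(_ \is a GRing.unit) unitrMl ?unitrV // unitrMr.
  rewrite dE unitmxE unitfE.
  by rewrite det_diag prodf_seq_neq0 => /allP/(_ i (mem_index_enum _)).
have hd : mx_exp_poly (fun m _ => diag_mx d ^+ m).
  move=> p q; have [l [l0 lE]] :=
    exp_polyM (exp_poly_exp (d0 p)) (exp_poly_cst (p == q)%:R).
  by exists l; split=> // m j; rewrite -(lE m j) diag_mx_exp !mxE mulr_natr.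
move=> p q.
have hM := mx_exp_polyM (mx_exp_polyM (mx_exp_poly_seq (mx_poly_seq_cst P^-1)) hd)
                        (mx_exp_poly_seq (mx_poly_seq_cst P)).
have [l [l0 lE]] := hM p q.
by exists l; split=> // m j; rewrite (conj_diag_exp _ Pu dE) -(lE m j).
Qed.

(** After diagonalising [s], a polynomial function of [s ^ m * u ^ j] is an
    exponential polynomial in [(m, j)].  It vanishes on the diagonal, where it is
    the value at [(s u) ^ m], hence everywhere, in particular at [m = 0]. *)
Theorem unipotent_part_zero (s u P : 'M[C]_n.+1) d k
    (f : mpoly.mpoly (n.+1 * n.+1) C) :
  P \is a GRing.unit -> s \is a GRing.unit -> P * s * P^-1 = diag_mx d ->
  (u - 1) ^+ k = 0 -> GRing.comm s u ->
  (forall m, mpoly.meval (mxvec ((s * u) ^+ m) 0) f = 0) ->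
  forall j, mpoly.meval (mxvec (u ^+ j) 0) f = 0.
Proof.
move=> Pu su dE nil csu f0 j.
have hsu := mx_exp_polyM (mx_exp_poly_diagonalizable Pu su dE)
                         (mx_exp_poly_seq (mx_poly_seq_unipotent nil)).
have hv i : exp_poly (fun m j => mxvec (s ^+ m * u ^+ j) 0 i).
  case/mxvec_indexP: i => p q; have [l [l0 lE]] := hsu p q.
  by exists l; split=> // m e; rewrite mxvecE.
have hf : exp_poly (fun m j => mpoly.meval (mxvec (s ^+ m * u ^+ j) 0) f).
  have [l [l0 lE]] := exp_poly_sum (mpoly.msupp f) (fun mon =>
    exp_polyM (exp_poly_cst (mpoly.mcoeff mon f))
     (exp_poly_prod (index_enum 'I_(n.+1 * n.+1)) (fun i =>
        exp_poly_pow (mpoly.fun_of_multinom mon i) (hv i)))).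
  by exists l; split=> // m e; rewrite mpoly.mevalE lE.
have := exp_poly_diag hf _ 0 j; rewrite expr0 mul1r; apply => m.
by rewrite -exprMn_comm.
Qed.
End MatrixSequences.

(** * Unipotent conjugation and hyperbolic recurrences *)

Section Recurrences.
Variable C : numFieldType.
Implicit Type p : {poly C}.

(** The leading coefficient [c] satisfies [2 c = T c]. *)
Lemma poly_rec_add p T : T != 2 ->
  (forall i : nat, p.[i.+2%:R] + p.[i%:R] = T * p.[i.+1%:R]) -> p = 0.
Proof.
move=> T2 H; have : shift (shift p) + p - T *: shift p = 0.
  by apply: poly_nat_eq0 => i; rewrite !hornerE !shiftE H subrr.
move/(congr1 (fun q : {poly C} => q`_(size p).-1)).
rewrite coef0 !coefD coefN coefZ.
have sE : (shift p)`_(size p).-1 = lead_coef p.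
  by rewrite -lead_coef_shift lead_coefE size_shift.
have -> : (shift (shift p))`_(size p).-1 = lead_coef p.
  by rewrite -lead_coef_shift -[in RHS]lead_coef_shift [in RHS]lead_coefE !size_shift.
rewrite sE -lead_coefE => /eqP.
rewrite (_ : _ - _ = (2 - T) * lead_coef p); last by ring.
by rewrite mulf_eq0 subr_eq0 eq_sym (negPf T2) lead_coef_eq0 => /eqP.
Qed.

(** Comparing degrees, [2 deg p = T deg p], so [p] is a constant [c] with
    [c ^ 2 = c ^ T]. *)
Lemma poly_rec_mul p T : (2 < T)%N -> p.[0] != 0 ->
  (forall i : nat, p.[i.+2%:R] * p.[i%:R] = p.[i.+1%:R] ^+ T) ->
  forall i : nat, p.[i%:R] ^+ (T - 2) = 1.
Proof.
move=> T2 pz H; have p0 : p != 0.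
  by apply: contraNneq pz => ->; rewrite horner0.
have e : shift (shift p) * p = shift p ^+ T.
  by apply/eqP; rewrite -subr_eq0; apply/eqP/poly_nat_eq0 => i;
     rewrite !hornerE !shiftE H subrr.
have sp0 : shift p != 0 by rewrite -size_poly_eq0 size_shift size_poly_eq0.
have ssp0 : shift (shift p) != 0 by rewrite -size_poly_eq0 size_shift size_poly_eq0.
have : size p = 1.
  have := congr1 (fun q : {poly C} => (size q).-1) e.
  rewrite size_exp size_mul // !size_shift.
  by have : (0 < size p)%N by [rewrite size_poly_gt0]; case: (size p) => // m _ /=; nia.
move=> s1; have /size_poly1P[c c0 pE] : size p == 1%N by apply/eqP.
move=> i; have := H i; rewrite pE !hornerC => cc.
apply: (mulfI (expf_neq0 2 c0)); rewrite -exprD mulr1 subnKC ?(ltnW T2) //.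
Qed.
End Recurrences.

Section Trig.
Variables (R : nzRingType) (n : nat).
Implicit Types A B : 'M[R]_n.+1.

(** Lower unitriangular matrices whose first [d - 1] subdiagonals vanish; the
    condition [d > 0] makes the diagonal entries equal to [1].  This is the
    descending central filtration, and the next subdiagonal is additive on it. *)
Definition unitrig d A :=
  forall p q : 'I_n.+1, (p < q + d)%N -> A p q = (p == q)%:R.

Lemma unitrig_mulE d A B (p q : 'I_n.+1) : (0 < d)%N ->
  unitrig d A -> unitrig d B -> (p <= q + d)%N ->
  (A * B) p q = if p == q then 1 else A p q + B p q.
Proof.
move=> d0 hA hB pq; rewrite mxE.
have z r : r != p -> r != q -> A p r * B r q = 0.
  move=> rp rq; have [pr|rp'] := ltnP p (r + d).
    by rewrite hA // eq_sym (negPf rp) mul0r.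
  rewrite hB ?(negPf rq) ?mulr0 //.
  by rewrite (leq_ltn_trans _ (_ : q < q + d)%N) //; lia.
have App r : A r r = 1 by rewrite hA ?eqxx //; lia.
have Bpp r : B r r = 1 by rewrite hB ?eqxx //; lia.
rewrite (bigD1 p) //= App mul1r; have [epq|npq] := eqVneq p q.
  by rewrite -epq in z *; rewrite Bpp big1 ?addr0 // => r rq; rewrite z.
rewrite (bigD1 q) /=; last by rewrite eq_sym.
by rewrite Bpp mulr1 big1 ?addr0 1?addrC // => r /andP[rp rq]; rewrite z.
Qed.

Lemma unitrigM d A B : (0 < d)%N -> unitrig d A -> unitrig d B -> unitrig d (A * B).
Proof.
move=> d0 hA hB p q pq; rewrite (unitrig_mulE d0) // 1?ltnW // hA // hB //.
by case: eqP => //; rewrite addr0.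
Qed.

Lemma unitrig_expE d A (p q : 'I_n.+1) T : (0 < d)%N ->
  unitrig d A -> p != q -> (p <= q + d)%N -> (A ^+ T) p q = T%:R * A p q.
Proof.
move=> d0 hA npq pq.
have : unitrig d (A ^+ T) /\ (A ^+ T) p q = T%:R * A p q.
  elim: T => [|T [IH1 IH2]].
    by rewrite expr0 mul0r mxE (negPf npq); split=> // r s _; rewrite mxE.
  rewrite exprS; split; first exact: unitrigM.
  by rewrite (unitrig_mulE d0) // (negPf npq) IH2 -nat1r mulrDl mul1r.
by case.
Qed.

Lemma is_trig_mxM A B : is_trig_mx A -> is_trig_mx B ->
  is_trig_mx (A * B) /\ forall p, (A * B) p p = A p p * B p p.
Proof.
move=> /is_trig_mxP hA /is_trig_mxP hB; split.
  apply/is_trig_mxP => p q pq; rewrite mxE big1 // => r _.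
  by have [pr|rp] := ltnP p r; [rewrite hA ?mul0r|rewrite hB ?mulr0 // (leq_ltn_trans rp)].
move=> p; rewrite mxE (bigD1 p) //= big1 ?addr0 // => r rp.
have [pr|rp'] := ltnP p r; first by rewrite hA ?mul0r.
by rewrite hB ?mulr0 // ltn_neqAle rp'  andbT; move: rp; apply: contra => /eqP/val_inj->.
Qed.

Lemma is_trig_mxX A m : is_trig_mx A ->
  is_trig_mx (A ^+ m) /\ forall p, (A ^+ m) p p = A p p ^+ m.
Proof.
move=> hA; elim: m => [|m [IH1 IH2]].
  split=> [|p]; last by rewrite !expr0 mxE eqxx.
  by apply/is_trig_mxP => p q pq; rewrite mxE; case: eqP pq => // ->; rewrite ltnn.
rewrite exprS; have [h1 h2] := is_trig_mxM hA IH1; split=> // p.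
by rewrite h2 IH2 exprS.
Qed.

End Trig.

(** The conjugates [B i] of [b] by [v ^ i] commute and satisfy
    [B (i + 2) * B i = B (i + 1) ^ T], and their entries are polynomials in [i]
    because [v] is unipotent.  In a basis where all of them are triangular, each
    diagonal entry satisfies the multiplicative recurrence, hence is a root of
    unity of order dividing [T - 2]; for the powers [B i ^ (T - 2)] the
    subdiagonals then satisfy the additive recurrence one after the other, hence
    vanish. *)
Theorem unipotent_conj_recurrence (C : numClosedFieldType) n
    (v b : 'M[C]_n.+1) k T :
  v \is a GRing.unit -> b \is a GRing.unit -> (v - 1) ^+ k = 0 -> (2 < T)%N ->
  GRing.comm b (v * b * v^-1) ->
  v ^+ 2 * b * v ^- 2 * b = (v * b * v^-1) ^+ T ->
  b ^+ (T - 2) = 1.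
Proof.
move=> vu bu nil T2 cb rel.
pose B (i : nat) : 'M[C]_n.+1 := v ^+ i * b * v ^- i.
have vXu i : v ^+ i \is a GRing.unit by rewrite unitrX.
have Bu i : B i \is a GRing.unit by rewrite /B !unitrMl ?unitrV // unitrMr.
have cjM (x y : 'M[C]_n.+1) i :
    v ^+ i * (x * y) * v ^- i = (v ^+ i * x * v ^- i) * (v ^+ i * y * v ^- i).
  by rewrite !mulrA mulrVK.
have cjX (x : 'M[C]_n.+1) e i : v ^+ i * (x ^+ e) * v ^- i = (v ^+ i * x * v ^- i) ^+ e.
  elim: e => [|e IH]; first by rewrite !expr0 mulr1 divrr.
  by rewrite !exprS cjM IH.
have Badd i j : v ^+ i * B j * v ^- i = B (j + i)%N.
  by rewrite /B addnC exprD invrM // !mulrA.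
have B1 : v * b * v^-1 = B 1%N by rewrite /B expr1.
have recB i : B i.+2 * B i = B i.+1 ^+ T.
  have := congr1 (fun x => v ^+ i * x * v ^- i) rel.
  by rewrite cjM B1 cjX -[v ^+ 2 * b * v ^- 2]/(B 2%N) !Badd add1n add2n.
have comB i : GRing.comm (B i) (B i.+1).
  have := congr1 (fun x => v ^+ i * x * v ^- i) cb.
  by rewrite B1 (cjM b (B 1%N)) (cjM (B 1%N) b) !Badd add1n.
have B2E i : B i.+2 = B i.+1 ^+ T * (B i)^-1 by rewrite -recB mulrK.
have comB2 i : GRing.comm (B i.+2) (B i).
  rewrite B2E; apply: commr_sym; apply: commrM.
    exact: commrX.
  by apply: commrV; exact: commr_refl.
(* The inverses are triangularised too, so that [B (i + 2)], which is
   [B (i + 1) ^ T / B i], and its inverse stay triangular. *)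
have [P Pun Ptrig] : exists2 P : 'M[C]_n.+1, P \is a GRing.unit &
   forall A, A \in [:: B 0%N; B 1%N; (B 0%N)^-1; (B 1%N)^-1] ->
     is_trig_mx (P * A * P^-1).
  have c01 := comB 0%N.
  have c0V : GRing.comm (B 0%N) (B 1%N)^-1 by apply: commrV.
  have cV1 : GRing.comm (B 0%N)^-1 (B 1%N).
    by apply: commr_sym; apply: commrV; apply: commr_sym.
  have cVV : GRing.comm (B 0%N)^-1 (B 1%N)^-1 by apply: commrV.
  have cr (x : 'M[C]_n.+1) : GRing.comm x x by apply: commr_refl.
  have cx (x : 'M[C]_n.+1) : GRing.comm x x^-1 by apply: commrV.
  have [|P Pu /allP Ptr] :=
      @cotrigonalization C _ [:: B 0%N; B 1%N; (B 0%N)^-1; (B 1%N)^-1].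
    move=> X Y; rewrite !inE => /or4P[]/eqP-> /or4P[]/eqP-> //;
      by [exact: cr|exact: cx|exact: c01|exact: c0V|exact: cV1|exact: cVV
         |apply: commr_sym].
  have Pu' := unitarymx_unit Pu.
  exists P => // A /Ptr /=; rewrite /similar_to conjumx //.
pose cj (A : 'M[C]_n.+1) : 'M[C]_n.+1 := P * A * P^-1.
have cjMu x y : cj (x * y) = cj x * cj y by rewrite /cj !mulrA mulrVK.
have cjXu x e : cj (x ^+ e) = cj x ^+ e.
  elim: e => [|e IH]; first by rewrite !expr0 /cj mulr1 divrr.
  by rewrite !exprS cjMu IH.
have trigB i : is_trig_mx (cj (B i)) /\ is_trig_mx (cj (B i)^-1).
  suff: (is_trig_mx (cj (B i)) /\ is_trig_mx (cj (B i)^-1)) /\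
        (is_trig_mx (cj (B i.+1)) /\ is_trig_mx (cj (B i.+1)^-1)) by case.
  elim: i => [|i [[h1 h2] [h3 h4]]].
    by split; split; apply: Ptrig; rewrite !inE eqxx ?orbT.
  split=> //; rewrite B2E; split.
    by rewrite cjMu cjXu; apply: (is_trig_mxM _ _).1 => //; apply: (is_trig_mxX _ _).1.
  rewrite invrM ?unitrX ?unitrV // invrK -exprVn cjMu cjXu.
  by apply: (is_trig_mxM _ _).1 => //; apply: (is_trig_mxX _ _).1.
have psB : mx_poly_seq (fun i => cj (B i)).
  have hv := mx_poly_seq_unipotent nil.
  have hV := mx_poly_seq_unipotent (unipotent_inv vu nil).
  have cst := @mx_poly_seq_cst C n.
  move=> p q; have [Q QE] := mx_poly_seqM (mx_poly_seqM (cst P)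
    (mx_poly_seqM (mx_poly_seqM hv (cst b)) hV)) (cst P^-1) p q.
  by exists Q => i; rewrite -QE /cj /B exprVn.
have diag1 i p : cj (B i) p p ^+ (T - 2) = 1.
  have [Q QE] := psB p p; rewrite QE; apply: poly_rec_mul T2 _ _ i.
    rewrite -[0]/(0%:R) -QE; apply/eqP => z.
    have := (is_trig_mxM (trigB 0%N).1 (trigB 0%N).2).2 p.
    rewrite z mul0r -cjMu divrr // /cj mulr1 divrr // mxE eqxx => /eqP.
    by rewrite oner_eq0.
  move=> i; rewrite -!QE.
  rewrite -(is_trig_mxM (trigB _).1 (trigB _).1).2 -cjMu recB cjXu.
  by rewrite (is_trig_mxX _ (trigB _).1).2.
pose E (i : nat) : 'M[C]_n.+1 := cj (B i) ^+ (T - 2).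
have recE i : E i.+2 * E i = E i.+1 ^+ T.
  rewrite /E -exprMn_comm; last by rewrite /GRing.comm -!cjMu comB2.
  by rewrite -cjMu recB cjXu exprAC.
have psE : mx_poly_seq E by apply: mx_poly_seqX.
have tE d : (0 < d)%N -> forall i, unitrig d (E i).
  elim: d => // d IH _; case: (posnP d) => [->|d0] i p q.
    rewrite addn1 ltnS leq_eqVlt => /predU1P[/val_inj->|pq].
      by rewrite eqxx (is_trig_mxX _ (trigB _).1).2.
    rewrite (is_trig_mxP (is_trig_mxX _ (trigB _).1).1) //.
    by case: eqP pq => // ->; rewrite ltnn.
  rewrite addnS ltnS leq_eqVlt => /predU1P[pq|]; last exact: IH.
  have npq : p != q by apply: contraTneq d0 => h; move: pq; rewrite h; lia.
  have pq' : (p <= q + d)%N by rewrite pq.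
  rewrite (negPf npq); have [Q QE] := psE p q; rewrite QE.
  suff -> : Q = 0 by rewrite horner0.
  apply: (@poly_rec_add _ _ T%:R); first by rewrite eqr_nat; lia.
  move=> {}i; rewrite -!QE -(unitrig_expE (d := d)) //; last exact: IH.
  by rewrite -recE (unitrig_mulE (d := d)) ?(negPf npq) //; apply: IH.
have : E 0%N = 1.
  apply/matrixP => p q; rewrite (tE n.+2) ?mxE //.
  by rewrite (leq_trans (ltn_ord p)) //; lia.
rewrite /E -cjXu /cj /B expr0 invr1 mul1r mulr1 => /(congr1 (fun x => P^-1 * x * P)).
by rewrite !mulrA mulVr // mul1r mulrVK // mulr1 mulVr.
Qed.

(** As [s] and [z s] are commuting diagonalisable matrices, [z] becomes diagonal
    in a common eigenbasis.  Conjugation by [t ^ i] carries [s] to [z ^ i s], so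
    [g ^ i * e] is an eigenvalue of [s] for all [i], where [g] and [e] are the
    eigenvalues of [z] and [s] on one basis vector.  There are only finitely many
    eigenvalues, so [g] is a root of unity. *)
Theorem commutator_finite_order (C : numClosedFieldType) n
    (s t z P : 'M[C]_n.+1) d :
  P \is a GRing.unit -> s \is a GRing.unit -> t \is a GRing.unit ->
  P * s * P^-1 = diag_mx d ->
  GRing.comm z s -> GRing.comm z t -> t * s * t^-1 = z * s ->
  exists2 M, (0 < M)%N & z ^+ M = 1.
Proof.
move=> Pu su tu dE czs czt rel.
have zsdiag : diagonalizable (z * s).
  exists (P * t^-1); first by rewrite -[_ \in _]/(_ \is a GRing.unit) unitrMl ?unitrV.
  apply/diagonalizable_forPex; exists d; apply/simmxRL.
    by rewrite -[_ \in _]/(_ \is a GRing.unit) unitrMl ?unitrV.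
  rewrite -rel -[invmx _]/((P * t^-1)^-1) -dE invrM ?unitrV // invrK.
  by rewrite -![_ *m _]/(_ * _) !mulrA !mulrVK.
have sdiag : diagonalizable s.
  by exists P => //; apply/diagonalizable_forPex; exists d; apply/simmxRL.
have [Q Qu /allP Qdiag] : codiagonalizable [:: s; z * s].
  apply/codiagonalizableP; split.
    have c : GRing.comm s (z * s).
      by apply: commrM; [exact: commr_sym|exact: commr_refl].
    by move=> A B; rewrite !inE => /orP[]/eqP-> /orP[]/eqP->;
      [exact: erefl|exact: c|exact: esym c|exact: erefl].
  by move=> A; rewrite !inE => /orP[]/eqP->.
have /diagonalizable_forPex[e /(simmxRL Qu) eE] := Qdiag _ (mem_head _ _).
have /diagonalizable_forPex[f /(simmxRL Qu) fE] :
  mxpoly.diagonalizable_for Q (z * s) by apply: Qdiag; rewrite !inE eqxx orbT.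
pose Z : 'M[C]_n.+1 := Q * z * Q^-1; pose g := \row_k (f 0 k / e 0 k).
have e0 k : e 0 k != 0.
  have : Q *m s *m invmx Q \in unitmx by rewrite !unitmx_mul Qu unitmx_inv Qu andbT.
  rewrite -eE unitmxE unitfE det_diag prodf_seq_neq0.
  by move/allP/(_ k (mem_index_enum _)).
have ZE : Z = diag_mx g.
  have ZeE : Z *m diag_mx e = diag_mx f.
    by rewrite fE eE -![_ *m _]/(_ * _) !mulrA mulrVK.
  apply/matrixP => p q; apply: (mulIf (e0 q)).
  have := congr1 (fun A : 'M[C]_n.+1 => A p q) ZeE; rewrite mul_mx_diag !mxE => ->.
  by case: eqP => [->|_]; rewrite ?mulr1n ?mulfVK // !mulr0n mul0r.
have tsE i : t ^+ i * s = z ^+ i * s * t ^+ i.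
  elim: i => [|i IH]; first by rewrite !expr0 mul1r mulr1.
  have ts : t * s = z * s * t by rewrite -rel mulrVK.
  rewrite exprSr -mulrA ts !mulrA -(commrX i czt) -(mulrA z) IH.
  by rewrite exprS !mulrA.
have eig i p : exists k, g 0 p ^+ i * e 0 p = e 0 k.
  pose W : 'M[C]_n.+1 := Q * t ^+ i * Q^-1.
  have WE : W *m diag_mx e = Z ^+ i *m diag_mx e *m W.
    have -> : Z ^+ i = Q * z ^+ i * Q^-1.
      rewrite (conj_diag_exp (x := z) (P := Q) (D := Z) i Qu) //.
      by rewrite !mulrA divrr // mul1r mulrK.
    rewrite eE /W -[RHS]/(_ * _ * _) -[LHS]/(_ * (_ * _ * Q^-1)).
    rewrite -[Q *m s *m invmx Q]/(Q * s * Q^-1).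
    by rewrite !mulrA !mulrVK // -(mulrA Q) tsE !mulrA.
  have [k Wk] : exists k, W p k != 0.
    have Wu : W \in unitmx.
      rewrite -[_ \in _]/(_ \is a GRing.unit).
      by rewrite !unitrMl ?unitrV // ?unitrX ?unitrMr ?unitrX.
    apply: contrapT => W0.
    have /(congr1 (fun A : 'M[C]_n.+1 => A p p)) : W *m invmx W = 1%:M.
      by rewrite mulmxV.
    rewrite !mxE eqxx big1 => [/eqP|k _]; first by rewrite eq_sym oner_eq0.
    have [->|Wk] := eqVneq (W p k) 0; first by rewrite mul0r.
    by case: W0; exists k.
  exists k; apply: (mulIf Wk).
  have := congr1 (fun A : 'M[C]_n.+1 => A p k) WE.
  rewrite ZE diag_mx_exp mul_mx_diag mulmx_diag mul_diag_mx !mxE => <-.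
  by rewrite mulrC.
have root1 p : g 0 p ^+ (n.+1)`! = 1.
  have /choice[F FE] : forall i : 'I_n.+2, exists k, g 0 p ^+ i * e 0 p = e 0 k.
    by move=> i; exact: eig.
  have : ~~ injectiveb F.
    by apply/injectiveP => /leq_card; rewrite !card_ord ltnn.
  case/injectivePn => i [j ij Fij].
  wlog lij : i j ij Fij / (i < j)%N.
    move=> W; case: (ltngtP i j) => [h|h|/val_inj h]; first exact: W h.
      by apply: (W j i) => //; rewrite eq_sym.
    by rewrite h eqxx in ij.
  have gE : g 0 p ^+ j = g 0 p ^+ i.
    by apply: (mulIf (e0 p)); rewrite !FE Fij.
  have gi0 : g 0 p ^+ i != 0.
    by apply: contraNneq (e0 (F i)) => h; rewrite -FE h mul0r.
  have g1 : g 0 p ^+ (j - i) = 1.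
    by apply: (mulfI gi0); rewrite -exprD subnKC ?(ltnW lij) // mulr1.
  have /dvdnP[c ->] : (j - i %| (n.+1)`!)%N.
    by apply: dvdn_fact; rewrite subn_gt0 lij /= (leq_trans (leq_subr _ _)) // -ltnS.
  by rewrite mulnC exprM g1 expr1n.
exists (n.+1)`!; first exact: fact_gt0.
rewrite (conj_diag_exp (x := z) (P := Q) (D := Z) _ Qu) // ZE diag_mx_exp.
have -> : diag_mx (\row_k g 0 k ^+ (n.+1)`!) = 1.
  by apply/matrixP => p q; rewrite [LHS]mxE [X in X *+ _]mxE root1 mxE.
by rewrite mulr1 mulVr.
Qed.

(** * The unipotent part of an element of an arithmetic group *)

Lemma subgroupM (T : groupType) (H : set T) x y :
  is_subgroup H -> H x -> H y -> H (x * y)%g.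
Proof.
move=> [H1 HF] Hx Hy; rewrite -[y]invgK; apply: (HF) => //.
by rewrite -[y^-1%g]mul1g; apply: (HF).
Qed.

Lemma subgroupV (T : groupType) (H : set T) x : is_subgroup H -> H x -> H (x^-1)%g.
Proof. by move=> [H1 HF] Hx; rewrite -[x^-1%g]mul1g; apply: (HF). Qed.

Lemma subgroupX (T : groupType) (H : set T) x k :
  is_subgroup H -> H x -> H (x ^+ k)%g.
Proof.
move=> HS Hx; elim: k => [|k IH]; first by case: HS.
by rewrite expgS; apply: subgroupM.
Qed.

(** Two of the cosets of the powers of [x] coincide. *)
Lemma finite_index_exp (T : groupType) (H G : set T) x :
  is_subgroup H -> finite_index H G -> (forall i, G (x ^+ i)%g) ->
  exists2 k, (0 < k)%N & H (x ^+ k)%g.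
Proof.
move=> HS [_ fin] Gx.
apply: contrapT => noexp.
pose F (i : nat) := left_coset (x ^+ i)%g H.
have neqF i j : (i < j)%N -> F i <> F j.
  move=> ij Fij; apply: noexp; exists (j - i)%N; first by rewrite subn_gt0.
  have : F i (x ^+ j)%g.
    by rewrite Fij; exists 1%g; [case: HS|rewrite mulg1].
  case=> h Hh hE; suff <- : h = (x ^+ (j - i))%g by [].
  by apply: (mulgI (x ^+ i)%g); rewrite hE -expgnDr subnKC // ltnW.
have injF : injective F.
  by move=> i j Fij; case: (ltngtP i j) => // /neqF; rewrite Fij.
apply: infinite_nat.
apply: (@sub_finite_set _ _ (F @^-1` [set left_coset y H | y in G])).
  by move=> i _ /=; exists (x ^+ i)%g.
by apply: finite_preimage fin => i j _ _; apply: injF.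
Qed.

Section GLFacts.
Variables (n : nat) (C : comUnitRingType).
Implicit Types x y : GL n.+1 C.

Lemma GLmxM x y : GLmx (x * y)%g = GLmx x * GLmx y.
Proof. by []. Qed.
Lemma GLmxV x : GLmx (x^-1)%g = (GLmx x)^-1.
Proof. by []. Qed.
Lemma GLmxX x k : GLmx (x ^+ k)%g = GLmx x ^+ k.
Proof. by elim: k => [|k IH] //; rewrite expgS exprS GLmxM IH. Qed.
Lemma GLmx_unit x : GLmx x \is a GRing.unit.
Proof. exact: Defs.GL_unit x. Qed.
End GLFacts.

Section ArithmeticUnipotent.
Variable R : realType.
Local Notation C := (complex R).
Local Notation ratmx := (map_mx (ratr : rat -> C)).

Lemma ratmx_inj m n : injective (@map_mx rat C ratr m n).
Proof.
move=> A B /matrixP AB; apply/matrixP => p q.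
by have := AB p q; rewrite !mxE => /fmorph_inj.
Qed.

Lemma Q_points_ratmx n (G : set (GL n.+1 C)) g : Q_points G g ->
  exists2 A : 'M[rat]_n.+1, A \is a GRing.unit & GLmx g = ratmx A.
Proof.
move=> [_ [gQ _]].
have /choice[A AE] : forall p : 'I_n.+1 * 'I_n.+1, exists a, GLmx g p.1 p.2 = ratr a.
  by move=> p; have [a _ <-] := gQ p.1 p.2; exists a.
have gE : GLmx g = ratmx (\matrix_(p, q) A (p, q)).
  by apply/matrixP => p q; rewrite !mxE -AE.
exists (\matrix_(p, q) A (p, q)) => //.
have := GLmx_unit g; rewrite gE -![_ \is a _]/(_ \in unitmx).
by rewrite map_unitmx.
Qed.

Lemma zero_locusX n P (a g : GL n.+1 C) (s u : 'M[rat]_n.+1) r k j :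
  is_subgroup (@zero_locus R _ P) -> zero_locus P a ->
  GLmx a = ratmx (s * u) -> s \is a GRing.unit -> GRing.comm s u ->
  (u - 1) ^+ k = 0 -> separable_poly r -> horner_mx s r = 0 ->
  GLmx g = ratmx u -> zero_locus P (g ^+ j)%g.
Proof.
move=> PG Pa aE su csu nil sep sr gE f Pf.
have [Q Qu [d dE]] := separable_diagonalizable C sep sr.
rewrite GLmxX gE.
apply: (unipotent_part_zero (s := ratmx s) (u := ratmx u) Qu _ dE (k := k)).
- by rewrite -[_ \is a _]/(_ \in unitmx) map_unitmx.
- have -> : ratmx u - 1 = ratmx (u - 1) by rewrite rmorphB rmorph1.
  by rewrite -rmorphXn nil rmorph0.
- by rewrite /GRing.comm -!rmorphM csu.
move=> m; rewrite -rmorphM.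
have := subgroupX m PG Pa; move/(_ f Pf).
by rewrite GLmxX aE.
Qed.

Lemma Z_points_unipotent n (G : set (GL n.+1 C)) (u : 'M[rat]_n.+1) k
    (g : GL n.+1 C) :
  u \is a GRing.unit -> (u - 1) ^+ k = 0 -> GLmx g = ratmx u ->
  (forall j, G (g ^+ j)%g) ->
  exists2 N, (0 < N)%N & forall j, Z_points G (g ^+ N ^+ j)%g.
Proof.
move=> uu nil gE Gg.
have [N N0 NP] := unipotent_exp_int nil.
have [M M0 MP] := unipotent_exp_int (unipotent_inv uu nil).
exists (N * M)%N; first by rewrite muln_gt0 N0.
have intP (A : 'M[rat]_n.+1) p q : A p q \is a Num.int ->
    range (fun z : int => z%:~R : C) ((ratmx A) p q).
  by move/intrP=> [z zE]; exists z => //; rewrite mxE zE ratr_int.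
move=> j; rewrite -expgnA; split; first exact: Gg.
split=> p q.
  rewrite GLmxX gE -rmorphXn; apply: intP; apply: NP.
  by rewrite -mulnA dvdn_mulr.
rewrite GLmxV GLmxX gE -exprVn -[(ratmx u)^-1]/(invmx (ratmx u)) -map_invmx -rmorphXn.
by apply: intP; apply: MP; rewrite mulnAC dvdn_mull.
Qed.

(** The witness [w] is a power of the unipotent part of [a].  The third property
    says that conjugation by a power of [w] is not hyperbolic, the fourth that
    [w] differs from a power of [a] by a semisimple factor only; both are visible
    in any group isomorphic to [Delta]. *)
Theorem arithmetic_unipotent_part n (G Delta : set (GL n C)) a :
  Q_defined_group G -> arithmetic_subgroup G Delta -> Delta a ->
  exists w, [/\ Delta w,
    (forall g, Delta g -> commute a g -> commute w g),
    (forall i b T, (2 < T)%N -> commute b (w ^+ i * b * w ^- i)%g ->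
       ((w ^+ i) ^+ 2 * b * (w ^+ i) ^- 2 * b = (w ^+ i * b * w ^- i) ^+ T)%g ->
       (b ^+ (T - 2) = 1)%g) &
    (forall i t z, (0 < i)%N -> Delta t -> Delta z -> commute z a -> commute z t ->
       commute (w ^+ i)%g t -> (t * a * t^-1 = z * a)%g ->
       exists2 m, (0 < m)%N & (z ^+ m = 1)%g)].
Proof.
case: n G Delta a => [|n] G Delta a [GS [P GE]] [DS DQ _ fin] Da.
  have triv (x y : GL 0 C) : x = y by apply: val_inj; rewrite [LHS]flatmx0 [RHS]flatmx0.
  exists 1%g; split => //; first by case: DS.
  by move=> i t z _ _ _ _ _ _ _; exists 1%N.
have [aQ aQu aE] := Q_points_ratmx (DQ _ Da).
have [s [u [aQE su [k nil] [r sep sr] com]]] := jordan_chevalley aQu.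
have csu : GRing.comm s u.
  have sa : GRing.comm s aQ by apply: com; apply: commr_refl.
  have -> : u = s^-1 * aQ by rewrite aQE mulKr.
  by apply: commrM => //; apply: commrV; apply: commr_refl.
have uu : u \is a GRing.unit by move: aQu; rewrite aQE unitrMr.
have comu b : GRing.comm aQ b -> GRing.comm u b.
  move=> ab; have -> : u = s^-1 * aQ by rewrite aQE mulKr.
  apply: commr_sym; apply: commrM; last exact: commr_sym.
  by apply: commrV; apply: commr_sym; apply: com.
have ugu : ratmx u \in unitmx by rewrite map_unitmx.
pose g := MkGL ugu.
have Gg j : G (g ^+ j)%g.
  rewrite GE; apply: (zero_locusX (a := a) (s := s) (u := u) j _ _ _ su csu nil sep sr).
  - by rewrite -GE.
  - by rewrite -GE; case: (DQ _ Da).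
  - by rewrite aE aQE.
  - by [].
have [N N0 NP] := Z_points_unipotent uu nil (erefl (GLmx g)) Gg.
have DZS : is_subgroup (Delta `&` Z_points G).
  split; first by split; [case: DS|have := NP 0%N].
  move=> x y [Dx [Gx [x1 x2]]] [Dy [Gy [y1 y2]]]; split; first by apply: DS.2.
  split; first by apply: GS.2.
  have rgM (A B : 'M[C]_n.+1) :
    (forall p q, range (fun z : int => z%:~R : C) (A p q)) ->
    (forall p q, range (fun z : int => z%:~R : C) (B p q)) ->
    (forall p q, range (fun z : int => z%:~R : C) ((A * B) p q)).
    move=> hA hB p q; rewrite mxE.
    have /choice[za zaE] : forall r, exists z, A p r = z%:~R.
      by move=> r'; have [z _ <-] := hA p r'; exists z.
    have /choice[zb zbE] : forall r, exists z, B r q = z%:~R.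
      by move=> r'; have [z _ <-] := hB r' q; exists z.
    exists (\sum_r' za r' * zb r') => //; rewrite rmorph_sum; apply: eq_bigr => r' _ /=.
    by rewrite zaE zbE rmorphM.
  split; first exact: rgM x1 y2.
  by rewrite invgM invgK; apply: rgM.
have [e e0 [De _]] := finite_index_exp DZS fin NP.
set w := (g ^+ N ^+ e)%g in De.
have wE : w = (g ^+ (N * e))%g by rewrite expgnA.
have wiE i : (w ^+ i)%g = (g ^+ (N * e * i))%g by rewrite expgnA wE.
have wnil i : exists k', (GLmx (w ^+ i)%g - 1) ^+ k' = 0.
  exists k; rewrite wiE GLmxX subrX1.
  have c1 : GRing.comm (ratmx u - 1) (\sum_(j < N * e * i) ratmx u ^+ j).
    apply: commr_sym; apply: commrB; last exact: commr1.
    by apply: commr_sym; apply: commr_sum => j _; apply: commrX; apply: commr_refl.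
  rewrite exprMn_comm //.
  have -> : ratmx u - 1 = ratmx (u - 1) by rewrite rmorphB rmorph1.
  by rewrite -rmorphXn nil rmorph0 mul0r.
exists w; split => //.
- move=> x Dx ax; have [xQ _ xE] := Q_points_ratmx (DQ _ Dx).
  have axQ : GRing.comm aQ xQ.
    apply: (@ratmx_inj n.+1 n.+1).
    by rewrite !map_mxM -aE -xE; have := congr1 (@GLmx _ _) ax.
  apply: val_inj => /=; rewrite -[LHS]/(GLmx w * GLmx x) -[RHS]/(GLmx x * GLmx w).
  rewrite wE GLmxX xE; apply: commr_sym; apply: commrX; apply: commr_sym.
  by rewrite /GRing.comm -!rmorphM comu.
- move=> i b T T2 cb rel; have [k' wk'] := wnil i.
  apply: val_inj; rewrite /= GLmxX.
  apply: (unipotent_conj_recurrence (GLmx_unit (w ^+ i)%g) (GLmx_unit b) wk' T2).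
    by have := congr1 (@GLmx _ _) cb; rewrite !GLmxM GLmxV.
  have := congr1 (@GLmx _ _) rel.
  by rewrite !GLmxM GLmxV (GLmxX _ 2) (GLmxX _ T) !GLmxM GLmxV.
- move=> i t z i0 Dt Dz cza czt cwt rel.
  pose E := (N * e * i)%N; have E0 : (0 < E)%N by rewrite !muln_gt0 N0 e0.
  have [zQ _ zE] := Q_points_ratmx (DQ _ Dz).
  have czaQ : GRing.comm aQ zQ.
    apply: (@ratmx_inj n.+1 n.+1).
    by rewrite !map_mxM -aE -zE; have := congr1 (@GLmx _ _) (esym cza).
  have czs : GRing.comm (GLmx z) (ratmx s).
    by rewrite zE /GRing.comm -!rmorphM (com _ czaQ).
  have [Q Qu [d dE]] := separable_diagonalizable C sep sr.
  (* The relation [t a t^-1 = z a] passes to the [E]-th powers, and the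
     unipotent factor [w ^ i] cancels because it commutes with [t]. *)
  have aEE : GLmx a ^+ E = ratmx s ^+ E * GLmx (w ^+ i)%g.
    by rewrite wiE GLmxX aE aQE rmorphM exprMn_comm // /GRing.comm -!rmorphM csu.
  have relE : GLmx t * (GLmx a ^+ E) * (GLmx t)^-1 = GLmx z ^+ E * GLmx a ^+ E.
    have : (t * a ^+ E * t^-1 = z ^+ E * a ^+ E)%g.
      rewrite -(expgMn _ cza) -rel; elim: E {E0 aEE} => [|m IH].
        by rewrite !expg0 mulg1 mulgV.
      by rewrite !expgS -IH !mulgA mulgVK.
    by move/(congr1 (@GLmx _ _)); rewrite !GLmxM GLmxV !GLmxX.
  have su' : ratmx s \is a GRing.unit.
    by rewrite -[_ \is a _]/(_ \in unitmx) map_unitmx.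
  have relS : GLmx t * (ratmx s ^+ E) * (GLmx t)^-1 = GLmx z ^+ E * ratmx s ^+ E.
    apply: (mulIr (GLmx_unit (w ^+ i)%g)).
    rewrite -[RHS]mulrA -aEE -relE aEE -!mulrA; congr (_ * (_ * _)).
    have := congr1 (@GLmx _ _) (commuteV cwt).
    by rewrite !GLmxM GLmxV => ->.
  have [m m0 zm] : exists2 m, (0 < m)%N & (GLmx z ^+ E) ^+ m = 1.
    have dEE : Q * ratmx s ^+ E * Q^-1 = diag_mx (\row_k d 0 k ^+ E).
      rewrite (conj_diag_exp (x := ratmx s) E Qu dE) -diag_mx_exp.
      by rewrite !mulrA divrr // mul1r mulrK.
    have sEu : ratmx s ^+ E \is a GRing.unit by rewrite unitrX.
    have c1 : GRing.comm (GLmx z ^+ E) (ratmx s ^+ E).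
      by apply: commrX; apply: commr_sym; apply: commrX; apply: commr_sym.
    have c2 : GRing.comm (GLmx z ^+ E) (GLmx t).
      have := congr1 (@GLmx _ _) (commuteX E (commute_sym czt)).
      by rewrite !GLmxM GLmxX => /commr_sym.
    exact: (commutator_finite_order Qu sEu (GLmx_unit t) dEE c1 c2 relS).
  exists (E * m)%N; first by rewrite muln_gt0 E0.
  by apply: val_inj; rewrite /= GLmxX exprM zm.
Qed.

End ArithmeticUnipotent.

(** * Automorphisms and inner automorphisms *)

Lemma commuteE (T : groupType) (x y : T) : commute x y <-> (x * y * x^-1 = y)%g.
Proof.
split=> [->|H]; first by rewrite mulgK.
by rewrite /commute -{2}H mulgVK.
Qed.

Section Inner.
Variable T : groupType.
Implicit Types (g h : T) (w : AutG T).

Fact inn_proof g :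
  `[< bijective (fun x => g * x * g^-1)%g /\
      {morph (fun x => g * x * g^-1)%g : x y / (x * y)%g} >].
Proof.
apply/asboolP; split; last by move=> x y; rewrite !mulgA mulgVK.
exists (fun x => g^-1 * x * g)%g => x.
  by rewrite !mulgA mulVg mul1g mulgVK.
by rewrite !mulgA mulgV mul1g mulgK.
Qed.

Definition inn g : AutG T := MkAut (inn_proof g).

Lemma autP w1 w2 : (forall x, w1 x = w2 x) -> w1 = w2.
Proof. by move=> H; apply: val_inj; apply: funext. Qed.

Lemma autM w : {morph w : x y / (x * y)%g}.
Proof. by case: w => f /= /asboolP[]. Qed.

Lemma aut_mulE w1 w2 x : (w1 * w2)%g x = w1 (w2 x).
Proof. by []. Qed.

Lemma aut_inj w : injective w.
Proof. by case: w => f /= /asboolP[/bij_inj]. Qed.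

Lemma aut1 w : w 1%g = 1%g.
Proof. by apply: (mulgI (w 1%g)); rewrite -autM !mulg1. Qed.

Lemma autV w x : w (x^-1)%g = (w x)^-1%g.
Proof. by apply: (mulgI (w x)); rewrite -autM !mulgV aut1. Qed.

Lemma autX w x k : w (x ^+ k)%g = (w x ^+ k)%g.
Proof. by elim: k => [|k IH]; rewrite ?expg0 ?aut1 // !expgS autM IH. Qed.

Lemma innM g h : inn (g * h)%g = (inn g * inn h)%g.
Proof. by apply: autP => x /=; rewrite invgM !mulgA. Qed.

Lemma inn1 : inn 1%g = 1%g.
Proof. by apply: autP => x /=; rewrite invg1 mulg1 mul1g. Qed.

Lemma innV g : inn (g^-1)%g = (inn g)^-1%g.
Proof. by apply: (mulgI (inn g)); rewrite -innM !mulgV inn1. Qed.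

Lemma innX g k : inn (g ^+ k)%g = (inn g ^+ k)%g.
Proof. by elim: k => [|k IH]; rewrite ?expg0 ?inn1 // !expgS innM IH. Qed.

Lemma inn_conj w g : (w * inn g * w^-1)%g = inn (w g).
Proof.
apply: (mulIg w); rewrite mulgVK; apply: autP => x.
by rewrite !aut_mulE /= !autM autV.
Qed.

Lemma inn_eq1 g x : inn g = 1%g -> (g * x = x * g)%g.
Proof.
move/(congr1 (fun w : AutG T => w x)) => /= H.
by rewrite -[in RHS]H mulgVK.
Qed.
End Inner.

(** * The infinite dihedral group *)

Section Generation.
Variables (D : groupType) (A tau : D).
Hypothesis D_dih : infinite_dihedral A tau.

Variable S : set D.
Hypotheses (S1 : S 1%g) (SF : forall x y, S x -> S y -> S (x * y^-1)%g).
Hypotheses (SA : S A) (St : S tau).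

Let Sp : {pred D} := [pred x | `[< S x >]].

Record dih_sub := DihSub { dih_val :> D; dih_valP : dih_val \in Sp }.
HB.instance Definition _ := [isSub for dih_val].
HB.instance Definition _ := [Choice of dih_sub by <:].
Fact Sp_closed : group_closed Sp.
Proof.
split; first exact/asboolP.
by move=> x y /asboolP Sx /asboolP Sy; apply/asboolP; apply: SF.
Qed.
HB.instance Definition _ := SubChoice_isSubGroup.Build D Sp dih_sub Sp_closed.

(** [A] and [tau] generate [D]: the universal property gives a morphism from [D]
    to the subgroup [S], and its composite with the inclusion is the identity by
    uniqueness. *)
Lemma dihedral_ind x : S x.
Proof.
case: D_dih => t2 At2 univ.
have SpA : A \in Sp by apply/asboolP.
have Spt : tau \in Sp by apply/asboolP.
have [||f [fA ft _]] := univ dih_sub (DihSub SpA) (DihSub Spt).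
- exact: val_inj.
- exact: val_inj.
have [h [hA ht huniq]] := univ D A tau t2 At2.
have eg1 := huniq idfun erefl erefl.
have eg2 := huniq (val \o f : {multiplicative _ -> _}).
have : x = val (f x).
  rewrite -[LHS]/(idfun x) eg1 -eg2 /= ?fA ?ft //.
move=> ->; exact/asboolP/(valP (f x)).
Qed.
End Generation.

(** * Units of norm one in a real quadratic order *)

Section GaloisConjugation.
Variables (K : splittingFieldType rat) (s : K).

Lemma intr_inj_rat_alg : injective (fun z : int => z%:~R : K).
Proof.
move=> a b /=; rewrite -!(rmorph_int (in_alg K)) => /fmorph_inj /eqP.
by rewrite eqr_int => /eqP.
Qed.

Lemma gal_nontrivial_sqrt (bar : gal_of {:K}) d :
  s ^+ 2 = d%:R -> <<1%AS; s>>%VS = fullv -> bar <> 1%g -> bar s = - s.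
Proof.
move=> sE K_gen bar_nontrivial.
have : (bar s) ^+ 2 = s ^+ 2 by rewrite -rmorphXn sE rmorph_nat.
move/eqP; rewrite eqf_sqr => /orP[/eqP bs|/eqP//].
case: bar_nontrivial; apply/eqP/gal_eqP => x _; rewrite gal_id.
have : (<<1%AS; s>> <= fixedField [set bar]%SET)%VS.
  apply/FadjoinP; split; first exact: sub1v.
  by apply/fixedFieldP; rewrite ?memvf // => y /set1P ->.
move/subvP/(_ x); rewrite K_gen => /(_ (memvf x)) /fixedFieldP.
by move/(_ (memvf x)); apply; apply: set11.
Qed.
End GaloisConjugation.

Section QuadraticField.
Variables (d : nat) (d_nonsquare : forall k : nat, d <> (k ^ 2)%N).
Variables (K : fieldType) (s : K).
Hypotheses (intK_inj : injective (fun z : int => z%:~R : K)) (sE : s ^+ 2 = d%:R).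
Variable bar : {rmorphism K -> K}.
Hypothesis bar_s : bar s = - s.

Lemma intK_eq0 (a : int) : (a%:~R == 0 :> K) = (a == 0).
Proof. by rewrite -[0]/((0 : int)%:~R) (inj_eq intK_inj). Qed.

Lemma barM x y : bar (x * y) = bar x * bar y.
Proof. exact: rmorphM. Qed.
Lemma barD x y : bar (x + y) = bar x + bar y.
Proof. exact: rmorphD. Qed.
Lemma bar_int (a : int) : bar a%:~R = a%:~R.
Proof. exact: rmorph_int. Qed.

Lemma s_neq0 : s != 0.
Proof.
apply/eqP => s0; apply: (d_nonsquare (k := 0)).
have /eqP := sE; rewrite s0 expr0n /= eq_sym -[d%:R]/((d%:Z)%:~R) intK_eq0.
by move/eqP => [].
Qed.

Definition inO (x : K) := exists a b : int, x = a%:~R + b%:~R * s.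

Lemma inO_qo (m : quad_order s) : inO (qo_val m).
Proof. by have /asboolP := qo_valP m. Qed.

Lemma inO_bar x : inO x -> inO (bar x).
Proof.
move=> [a [b ->]]; exists a, (- b).
by rewrite barD barM !bar_int bar_s rmorphN mulrN mulNr.
Qed.

Lemma inOM x y : inO x -> inO y -> inO (x * y).
Proof.
move=> [a [b ->]] [a' [b' ->]]; exists (a * a' + b * b' * d%:Z), (a * b' + b * a').
have -> : (a%:~R + b%:~R * s) * (a'%:~R + b'%:~R * s) =
  a%:~R * a'%:~R + b%:~R * b'%:~R * s ^+ 2 +
  (a%:~R * b'%:~R + b%:~R * a'%:~R) * s by ring.
by rewrite sE !rmorphD !rmorphM.
Qed.

Lemma inOX x k : inO x -> inO (x ^+ k).
Proof.
move=> Ox; elim: k => [|k IH]; last by rewrite exprS; apply: inOM.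
by exists 1, 0; rewrite mul0r addr0.
Qed.

Lemma norm_int x : inO x -> exists N : int, x * bar x = N%:~R.
Proof.
move=> [a [b ->]]; exists (a ^+ 2 - b ^+ 2 * d%:Z).
rewrite barD barM !bar_int bar_s.
have -> : (a%:~R + b%:~R * s) * (a%:~R + b%:~R * - s) =
  a%:~R ^+ 2 - b%:~R ^+ 2 * s ^+ 2 by ring.
by rewrite sE rmorphB rmorphXn rmorphM rmorphXn.
Qed.

Variable eps : K.
Hypotheses (eps_O : inO eps) (eps_norm : eps * bar eps = 1).
Hypothesis eps_inf : forall k : nat, (0 < k)%N -> eps ^+ k <> 1.

Lemma eps0 : eps != 0.
Proof.
by apply/eqP => e0; move/eqP: eps_norm; rewrite e0 mul0r eq_sym oner_eq0.
Qed.

Lemma epsU : eps \is a GRing.unit. Proof. by rewrite unitfE eps0. Qed.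

Lemma bar_eps : bar eps = eps^-1.
Proof. by apply: (mulfI eps0); rewrite eps_norm divff ?eps0. Qed.

Lemma bar_eps_exp (i : int) : bar (eps ^ i) = eps ^ (- i).
Proof. by rewrite rmorphXz ?epsU //= bar_eps exprz_inv. Qed.

Lemma eps_exp_O (i : int) : inO (eps ^ i).
Proof.
case: i => k; first exact: inOX.
by rewrite NegzE -bar_eps_exp; apply: inO_bar; apply: inOX.
Qed.

Lemma eps_exp_inj : injective (fun i : int => eps ^ i).
Proof.
have e1 (i : int) : eps ^ i = 1 -> i = 0.
  have pos (k : nat) : eps ^ k%:Z = 1 -> k = 0%N.
    by case: (posnP k) => // k0 /(eps_inf k0).
  case: i => k; first by move/pos->.
  by move/eqP; rewrite -[eps ^ _]/((eps ^+ k.+1)^-1) invr_eq1 => /eqP/eps_inf; case.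
move=> i j /= ij; apply/eqP; rewrite -subr_eq0; apply/eqP/e1.
by rewrite expfzDr ?eps0 // ij -expfzDr ?eps0 // subrr.
Qed.

Lemma eps_exp_coord (i : int) : i != 0 ->
  exists p q : int, [/\ eps ^ i = p%:~R + q%:~R * s, q != 0 &
    p ^+ 2 - q ^+ 2 * d%:Z = 1].
Proof.
move=> i0; have [p [q pq]] := eps_exp_O i; exists p, q.
have N1 : p ^+ 2 - q ^+ 2 * d%:Z = 1.
  apply: intK_inj; rewrite /= rmorphB rmorphXn rmorphM rmorphXn.
  have : eps ^ i * bar (eps ^ i) = 1 by rewrite bar_eps_exp -expfzDr ?eps0 // subrr.
  rewrite pq barD barM !bar_int bar_s => <-.
  rewrite /= -pmulrn -sE; ring.
split=> //; apply: contra i0 => /eqP q0.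
suff : eps ^ (i * 2) = eps ^ (0 : int) by move/eps_exp_inj; lia.
rewrite expr0z -exprz_exp -exprnP pq q0 mul0r addr0 -rmorphXn.
by move: N1; rewrite q0 expr0n mul0r subr0 => ->.
Qed.

(** The trace [T] of [eps ^ (2 i)] is [4 p ^ 2 - 2] when [eps ^ i = p + q s]: it
    is even, and it exceeds [2] because [p ^ 2 = 1 + d q ^ 2] with [q <> 0]. *)
Lemma eps_trace (i : int) : i != 0 ->
  exists T : nat, [/\ (2 < T)%N, ~~ odd T &
    eps ^ (i * 4) + 1 = T%:R * eps ^ (i * 2)].
Proof.
move=> i0; have [p [q [pq q0 N1]]] := eps_exp_coord i0.
have p2 : (4 <= p ^+ 2)%R.
  have d2 : (2 <= d)%N.
    by case: d d_nonsquare => [/(_ 0%N)//|[/(_ 1%N)//|//]].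
  have q1 : (1 <= q ^+ 2)%R by move: q0; clear; nia.
  have p3 : (3 <= p ^+ 2)%R by nia.
  have [p1|p1] := leP 2 `|p|; first by nia.
  by nia.
pose T := (`|(4 * p ^+ 2 - 2)%R|)%N.
have TZ : T%:Z = 4 * p ^+ 2 - 2 by rewrite /T; lia.
exists T; split; [by lia|by lia|].
have TE : T%:R = 4 * p%:~R ^+ 2 - 2 :> K.
  by rewrite pmulrn TZ rmorphB rmorphM rmorphXn.
have N1K : p%:~R ^+ 2 - q%:~R ^+ 2 * s ^+ 2 = 1 :> K.
  have := congr1 (fun z : int => z%:~R : K) N1.
  by rewrite rmorphB rmorphXn rmorphM rmorphXn /= -pmulrn -sE.
rewrite TE -!exprz_exp -!exprnP pq.
set P := p%:~R in N1K *; set Q := q%:~R in N1K *.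
(* With [P - Q s] the inverse of [P + Q s], the sum of their squares is the trace. *)
have -> : (P + Q * s) ^+ 4 + 1 =
    (P + Q * s) ^+ 4 + (P ^+ 2 - Q ^+ 2 * s ^+ 2) ^+ 2 by rewrite N1K expr1n.
have -> : 4 * P ^+ 2 - 2 = 4 * P ^+ 2 - 2 * (P ^+ 2 - Q ^+ 2 * s ^+ 2).
  by rewrite N1K mulr1.
ring.
Qed.

End QuadraticField.

(** * Integral powers and the normal form in the dihedral group *)

Section IntPower.
Variables (T : groupType) (x : T).

Definition expgz (i : int) : T :=
  match i with Posz k => x ^+ k | Negz k => x ^- k.+1 end%g.

Lemma expgz_succ i : expgz (i + 1) = (expgz i * x)%g.
Proof.
case: i => k; first by rewrite -PoszD addn1 /= expgSr.
case: k => [|k]; first by rewrite /= expg1 mulVg.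
rewrite (_ : _ + 1 = Negz k); last by lia.
by rewrite -[expgz (Negz k.+1)]/(x ^- k.+2)%g expgS invgM mulgVK.
Qed.

Lemma expgzD i j : expgz (i + j) = (expgz i * expgz j)%g.
Proof.
have nat_case (k : nat) i' : expgz (i' + k%:Z) = (expgz i' * x ^+ k)%g.
  elim: k => [|k IH]; first by rewrite addr0 expg0 mulg1.
  by rewrite -addn1 PoszD addrA expgz_succ IH addn1 expgSr mulgA.
case: j => k; first exact: nat_case.
by rewrite -[in RHS](subrK k.+1%:Z i) nat_case /= mulgK NegzE.
Qed.

Lemma expgzN i : expgz (- i) = (expgz i)^-1%g.
Proof. by apply: (mulgI (expgz i)); rewrite -expgzD subrr mulgV. Qed.

Lemma expgzX i k : (expgz i ^+ k)%g = expgz (i * k%:Z).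
Proof.
elim: k => [|k IH]; first by rewrite mulr0.
by rewrite expgSr IH -expgzD -addn1 PoszD mulrDr mulr1.
Qed.

End IntPower.

Lemma expgz_exp (T : groupType) (x : T) k i : expgz (x ^+ k)%g i = expgz x (i * k%:Z).
Proof.
case: i => m; first by rewrite -PoszM mulnC; exact: esym (expgnA _ _ _).
rewrite NegzE mulNr !expgzN -PoszM mulnC; congr (_^-1)%g.
exact: esym (expgnA _ _ _).
Qed.


Lemma aut_expgz (T : groupType) (w : AutG T) x i : w (expgz x i) = expgz (w x) i.
Proof. by case: i => k /=; rewrite ?autV autX. Qed.

Section Dihedral.
Variables (D : groupType) (A tau : D).
Hypothesis D_dih : infinite_dihedral A tau.
Notation zp := (expgz A).

Lemma dih_tau2 : (tau * tau = 1)%g.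
Proof. by case: D_dih => t2 _ _; rewrite -expg2. Qed.

Lemma dih_tauV : (tau^-1 = tau)%g.
Proof. by apply: (mulgI tau); rewrite mulgV dih_tau2. Qed.

Lemma dih_tau_zp i : (tau * zp i = zp (- i) * tau)%g.
Proof.
have tAt : inn tau A = (A^-1)%g.
  case: D_dih => t2 At2 _; rewrite /= dih_tauV; apply: (mulgI A).
  by rewrite mulgV -At2 expg2 !mulgA.
have VE j : expgz (A^-1)%g j = zp (- j).
  rewrite expgzN; case: j => k /=; first by rewrite expVgn.
  by rewrite expVgn.
apply: (mulIg (tau^-1)%g); rewrite mulgK -VE -tAt.
by rewrite -(aut_expgz (inn tau)).
Qed.

Lemma dih_normal_form x : exists i, x = zp i \/ x = (zp i * tau)%g.
Proof.
apply: (dihedral_ind D_dih (S := [set x | exists i, x = zp i \/ x = (zp i * tau)%g])).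
- by exists 0; left.
- move=> y z [i [->|->]] [j [->|->]].
  + by exists (i - j); left; rewrite expgzD expgzN.
  + exists (i + j); right; rewrite invgM dih_tauV expgzD -expgzN.
    by rewrite dih_tau_zp opprK mulgA.
  + exists (i + j); right; rewrite -expgzN -mulgA dih_tau_zp opprK expgzD.
    by rewrite mulgA.
  + exists (i - j); left.
    by rewrite invgM mulgA mulgK expgzD expgzN.
- by exists 1; left.
- by exists 0; right; rewrite mul1g.
Qed.

Lemma dih_reflM i j : (zp i * tau * (zp j * tau) = zp (i - j))%g.
Proof.
by rewrite -mulgA (mulgA tau) dih_tau_zp -mulgA dih_tau2 mulg1 -expgzD.
Qed.
End Dihedral.

Lemma mulrz_pair (U V : zmodType) (u : U * V) (z : int) : u *~ z = (u.1 *~ z, u.2 *~ z).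
Proof.
have natP n : u *+ n = (u.1 *+ n, u.2 *+ n).
  by elim: n => [|n IH]; rewrite ?mulr0n // !mulrS IH.
by case: z => n; rewrite ?NegzE ?mulrNz -!pmulrn natP.
Qed.

(** * The group [Gamma] and its automorphisms *)

Section Gamma.
Variables (d : nat) (d_nonsquare : forall k : nat, d <> (k ^ 2)%N).
Variables (K : fieldType) (s : K).
Hypotheses (intK_inj : injective (fun z : int => z%:~R : K)) (sE : s ^+ 2 = d%:R).
Variable bar : {rmorphism K -> K}.
Hypothesis bar_s : bar s = - s.
Variable eps : quad_order s.
Hypotheses (eps_norm : qo_val eps * bar (qo_val eps) = 1).
Hypothesis eps_inf : forall k : nat, (0 < k)%N -> qo_val eps ^+ k <> 1.
Variables (D : groupType) (A tau : D).
Hypothesis D_dih : infinite_dihedral A tau.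
Variable act : group_action D (quad_order s * int)%type.
Hypothesis act_A : forall (m : quad_order s) (n : int),
     qo_val (act A (m, n)).1 = qo_val eps * qo_val m /\ (act A (m, n)).2 = n.
Hypothesis act_tau : forall (m : quad_order s) (n : int),
     qo_val (act tau (m, n)).1 = bar (qo_val m) /\ (act tau (m, n)).2 = - n.

Local Notation F := (quad_order s * int)%type.
Local Notation Gam := (semidirect act).
Local Notation e := (qo_val eps).
Local Notation zp := (expgz A).
Local Notation val1 u := (qo_val u.1).

Let e0 : e != 0. Proof. exact: (eps0 eps_norm). Qed.
Let eO : inO s e. Proof. exact: inO_qo. Qed.
Let e_inj : injective (fun i : int => e ^ i).
Proof. exact: eps_exp_inj eps_norm eps_inf. Qed.

Lemma quad_pairP (u v : F) : val1 u = val1 v -> u.2 = v.2 -> u = v.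
Proof. by case: u v => [m n] [m' n'] /= /val_inj -> ->. Qed.

Lemma act_zp i (u : F) : val1 (act (zp i) u) = e ^ i * val1 u /\ (act (zp i) u).2 = u.2.
Proof.
have nat_case (k : nat) (v : F) :
    val1 (act (A ^+ k)%g v) = e ^+ k * val1 v /\ (act (A ^+ k)%g v).2 = v.2.
  elim: k v => [|k IH] v; first by rewrite expg0 act_one expr0 mul1r.
  rewrite expgS act_mul; case: (IH v); case: (act (A ^+ k)%g v) => m n /= mE nE.
  by have [-> ->] := act_A m n; rewrite mE nE exprS mulrA.
case: i => k; first exact: nat_case.
have := nat_case k.+1 (act (zp (Negz k)) u).
rewrite -act_mul /= mulgV act_one => -[H ->]; split=> //.
rewrite H -[e ^ Negz k]/((e ^+ k.+1)^-1) mulKf //.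
by rewrite expf_neq0.
Qed.

Lemma act_refl i (u : F) :
  val1 (act (zp i * tau)%g u) = e ^ i * bar (val1 u) /\
  (act (zp i * tau)%g u).2 = - u.2.
Proof.
rewrite act_mul; have [-> ->] := act_zp i (act tau u).
by case: u => m n; have [-> ->] := act_tau m n.
Qed.

Fact one_inO : 1 \in in_order s.
Proof. by apply/asboolP; exists 1, 0; rewrite mul0r addr0. Qed.
Fact sqrt_inO : s \in in_order s.
Proof. by apply/asboolP; exists 0, 1; rewrite mul1r add0r. Qed.
Definition oneO := MkQuadOrder one_inO.
Definition sqrtO := MkQuadOrder sqrt_inO.

Lemma valD (m m' : quad_order s) : qo_val (m + m') = qo_val m + qo_val m'.
Proof. by []. Qed.
Lemma val1_mulrn (u : F) k : val1 (u *+ k) = val1 u *+ k /\ (u *+ k).2 = u.2 *+ k.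
Proof.
by elim: k => [|k [IH1 IH2]]; rewrite ?mulr0n // !mulrS /= IH1 IH2.
Qed.

Lemma val_mulrz (m : quad_order s) (z : int) : qo_val (m *~ z) = qo_val m * z%:~R.
Proof.
have natP n : qo_val (m *+ n) = qo_val m *+ n.
  by elim: n => [|n IH]; rewrite ?mulr0n // !mulrS valD IH.
have valN (m' : quad_order s) : qo_val (- m') = - qo_val m' by [].
case: z => n; first by rewrite -!pmulrn natP mulr_natr.
by rewrite NegzE !mulrNz valN -!pmulrn natP mulrN mulr_natr.
Qed.

Lemma quad_order_coord (m : quad_order s) :
  exists a b : int, m = oneO *~ a + sqrtO *~ b.
Proof.
have [a [b ab]] := inO_qo m; exists a, b; apply: val_inj.
rewrite -[LHS]/(qo_val m) -[RHS]/(qo_val (_ + _)) ab.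
by rewrite valD !val_mulrz mul1r [s * _]mulrC.
Qed.

Lemma val1D (u v : F) : val1 (u + v) = val1 u + val1 v /\ (u + v).2 = u.2 + v.2.
Proof. by []. Qed.

Definition emb (u : F) : Gam := (u, 1%g).
Definition sec (x : D) : Gam := (0, x).

Lemma gamM (g h : Gam) : (g * h)%g = (g.1 + act g.2 h.1, (g.2 * h.2)%g).
Proof. by []. Qed.

Lemma snd_gamX (g : Gam) k : (g ^+ k)%g.2 = (g.2 ^+ k)%g.
Proof. by elim: k => [//|k IH]; rewrite !expgS gamM /= IH. Qed.

Lemma emb0 : emb 0 = 1%g. Proof. by []. Qed.

Lemma embD u v : emb (u + v) = (emb u * emb v)%g.
Proof. by rewrite gamM /= act_one mulg1. Qed.

Lemma embX u k : emb (u *+ k) = (emb u ^+ k)%g.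
Proof. by elim: k => [//|k IH]; rewrite expgS -IH -embD mulrS. Qed.

Lemma emb_comm u v : commute (emb u) (emb v).
Proof. by rewrite /commute -!embD addrC. Qed.

Lemma secM x y : sec (x * y)%g = (sec x * sec y)%g.
Proof. by rewrite gamM /= add0r act_zero. Qed.

Lemma secX x k : sec (x ^+ k)%g = (sec x ^+ k)%g.
Proof. by elim: k => [//|k IH]; rewrite !expgS secM IH. Qed.

Lemma sec_emb x u : (sec x * emb u)%g = (emb (act x u) * sec x)%g.
Proof. by rewrite !gamM /= mulg1 mul1g add0r act_one addr0. Qed.

Lemma gam_split (g : Gam) : g = (emb g.1 * sec g.2)%g.
Proof. by case: g => u x; rewrite gamM /= act_one mul1g addr0. Qed.

Lemma zp_inj i j : zp i = zp j -> i = j.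
Proof.
move=> ij; apply: e_inj => /=.
have := (act_zp i (oneO, 0)).1; rewrite ij (act_zp j _).1 /= !mulr1.
by [].
Qed.

Lemma emb_eq1 u : emb u = 1%g -> u = 0.
Proof. by case. Qed.

(** A rotation acts on [O] by a power of [eps], and a reflection acts on the
    second factor by [-1]. *)
Lemma act_faithful x : (forall u, act x u = u) -> x = 1%g.
Proof.
move=> actx; have [i [xE|xE]] := dih_normal_form D_dih x.
  have := (act_zp i (oneO, 0)).1; rewrite -xE actx /= mulr1 => /esym.
  by rewrite -[1](expr0z e) => /e_inj i0; rewrite xE i0.
by have := (act_refl i (0, 1)).2; rewrite -xE actx.
Qed.

(** A central element acts trivially on [F], hence lies in [F]; its vector is
    fixed by [A], which kills the component in [O], and by [tau], which kills
    the other one. *)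
Lemma gam_center (g : Gam) : (forall h, g * h = h * g)%g -> g = 1%g.
Proof.
case: g => u x gC.
have x1 : x = 1%g.
  apply: act_faithful => v.
  have := congr1 (@fst _ _) (gC (emb v)); rewrite !gamM /= act_one addrC.
  by move/addIr.
have fixu y : act y u = u.
  have := congr1 (@fst _ _) (gC (sec y)); rewrite !gamM /= act_zero addr0 add0r.
  by move=> <-.
suff u0 : u = 0 by rewrite u0 x1.
apply: quad_pairP.
  have := (act_zp 1 u).1; rewrite fixu expr1z => /eqP.
  rewrite -subr_eq0 -{1}[val1 u]mul1r -mulrBl mulf_eq0 subr_eq0.
  case/orP => /eqP // e1.
  have : (0 : int) = 1 by apply: e_inj; rewrite /= expr0z.
  by [].
have := (act_refl 0 u).2; rewrite fixu /=; lia.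
Qed.

Lemma inn_inj_gam (g h : Gam) : inn g = inn h -> g = h.
Proof.
move=> gh; apply/divg1_eq/gam_center => x; apply: inn_eq1.
by rewrite innM innV gh mulgV.
Qed.

Lemma aut_ext (w1 w2 : AutG Gam) :
  (forall u, w1 (emb u) = w2 (emb u)) ->
  w1 (sec A) = w2 (sec A) -> w1 (sec tau) = w2 (sec tau) -> w1 = w2.
Proof.
move=> wF wA wt; apply: autP => g; rewrite (gam_split g) !autM wF; congr (_ * _)%g.
apply: (dihedral_ind D_dih (S := [set x | w1 (sec x) = w2 (sec x)])) => //=.
  by rewrite !aut1.
move=> x y xE yE; have secV z : sec (z^-1)%g = (sec z)^-1%g.
  by apply: (mulgI (sec z)); rewrite -secM !mulgV.
by rewrite secM !autM secV !autV xE yE.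
Qed.

(** The elements [(0, 1) A] and [tau] of [Gamma] satisfy the relations of [D],
    which yields a section of the projection to [D]; the shear is the identity
    on [F] and this section on [D]. *)
Lemma exists_shear : exists th : AutG Gam,
  [/\ forall u, th (emb u) = emb u,
      th (sec A) = (emb (0, 1%R) * sec A)%g & th (sec tau) = sec tau].
Proof.
have [||f [fA ft _]] := (let: And3 _ _ univ := D_dih in univ) Gam
    (emb (0, 1%R) * sec A)%g (sec tau).
- by rewrite -secX expg2 (dih_tau2 D_dih).
- rewrite -mulgA -secM expg2 !gamM /= act_one mul1g.
  congr (_, _); last first.
    by case: D_dih => _ At2 _; rewrite -expg2.
  have [h1 h2] := act_refl 1 (0, 1).
  apply: quad_pairP; rewrite addr0; last by rewrite (val1D _ _).2 h2.
  by rewrite (val1D _ _).1 h1 /= rmorph0 mulr0 addr0.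
have f1 : f 1%g = 1%g by apply: (mulgI (f 1%g)); rewrite -gmulfM !mulg1.
have fV x : f (x^-1)%g = (f x)^-1%g.
  by apply: (mulgI (f x)); rewrite -gmulfM !mulgV f1.
have f2 x : (f x).2 = x.
  apply: (dihedral_ind D_dih (S := [set x | (f x).2 = x])) => /=.
  - by rewrite f1.
  - by move=> y z yE zE; rewrite gmulfM fV gamM /= yE zE.
  - by rewrite fA /= mul1g.
  - by rewrite ft.
pose h (g : Gam) : Gam := (emb g.1 * f g.2)%g.
have hE g : h g = (g.1 + (f g.2).1, g.2).
  by rewrite /h gamM /= act_one mul1g f2.
have hP : `[< bijective h /\ {morph h : x y / (x * y)%g} >].
  apply/asboolP; split.
    exists (fun g : Gam => (g.1 - (f g.2).1, g.2)); move=> [u x];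
    by rewrite !hE /= ?addrK ?subrK.
  move=> [u x] [v y]; rewrite /h /= gmulfM -!mulgA embD -mulgA; congr (_ * _)%g.
  rewrite !mulgA; congr (_ * _)%g.
  by rewrite !gamM /= f2 !act_one mulg1 mul1g addrC.
exists (MkAut hP); split=> [u||] /=.
- by rewrite hE /= f1 addr0.
- by rewrite /h /= fA emb0 mul1g.
- by rewrite /h /= ft emb0 mul1g.
Qed.

(** An automorphism that commutes with conjugation by [A ^ k] fixes [A ^ k],
    since the centre is trivial; such automorphisms preserve the decomposition
    of [F] into its isotypic parts under [A ^ k]. *)
Section Normalised.
Variables (w : AutG Gam) (k : nat).
Hypotheses (k_gt0 : (0 < k)%N) (wA : w (sec A ^+ k)%g = (sec A ^+ k)%g).

Lemma aut_fixes_sec_zp i : w (sec (zp (i * k%:Z))) = sec (zp (i * k%:Z)).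
Proof.
have secz j : sec (zp j) = expgz (sec A) j.
  have secV x : sec (x^-1)%g = (sec x)^-1%g.
    by apply: (mulgI (sec x)); rewrite -secM !mulgV.
  by case: j => m /=; rewrite ?secV secX.
have -> : sec (zp (i * k%:Z)) = expgz (sec A ^+ k)%g i by rewrite secz expgz_exp.
by rewrite aut_expgz wA.
Qed.

Lemma sec_conj_emb x u : (sec x * emb u * (sec x)^-1)%g = emb (act x u).
Proof. by rewrite sec_emb mulgK. Qed.

(** With [Bi] for [A ^ (i k)], elements [x] of [O] satisfy
    [B4 x B4^-1 x = (B2 x B2^-1) ^ T], and so do their images.  Modulo [F] this
    excludes rotations other than [1] since [T <> 2], and reflections since [T]
    is even; on the second factor of [F] it reads [2 n = T n]. *)
Lemma aut_preserves_O m : exists m', w (emb (m, 0)) = emb (m', 0).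
Proof.
have [T [T2 Todd Te]] := eps_trace d_nonsquare intK_inj sE bar_s eO eps_norm eps_inf
  (i := k%:Z) (lt0n_neq0 k_gt0).
pose B i := sec (zp (i * k%:Z)).
have wB i : w (B i) = B i := aut_fixes_sec_zp i.
have rec : (B 4 * emb (m, 0) * (B 4)^-1 * emb (m, 0) =
            (B 2 * emb (m, 0) * (B 2)^-1) ^+ T)%g.
  rewrite !sec_conj_emb -embX -embD; congr emb; apply: quad_pairP.
    rewrite (val1_mulrn _ _).1 (val1D _ _).1 (act_zp (4 * _) _).1 (act_zp (2 * _) _).1.
    by rewrite -[X in _ + X]mul1r -mulrDl ![_ * k%:Z]mulrC Te -mulrA mulr_natl.
  rewrite (val1_mulrn _ _).2 (val1D _ _).2.
  by rewrite (act_zp (4 * _) _).2 (act_zp (2 * _) _).2 mul0rn.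
have := congr1 w rec; rewrite autX !autM !autV !wB.
case: (w (emb (m, 0))) => v x recw.
have recx : (zp (4 * k%:Z) * x * (zp (4 * k%:Z))^-1 * x =
            (zp (2 * k%:Z) * x * (zp (2 * k%:Z))^-1) ^+ T)%g.
  by have := congr1 (@snd _ _) recw; rewrite snd_gamX.
have x1 : x = 1%g.
  have [i [xE|xE]] := dih_normal_form D_dih x.
    move: recx; rewrite xE -!expgzN -!expgzD expgzX => /zp_inj H.
    by have -> : i = 0; [nia|].
  have zr j : (zp j * x * (zp j)^-1 = zp (j + j + i) * tau)%g.
    rewrite xE -expgzN -!mulgA (dih_tau_zp D_dih) opprK !mulgA -!expgzD.
    by congr (expgz _ _ * _)%g; lia.
  move: recx; rewrite !zr (_ : T = 2 * T./2)%N; last by lia.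
  rewrite expgnA expg2 (dih_reflM D_dih) subrr expg1n xE (dih_reflM D_dih).
  by rewrite -[RHS]/(zp 0) => /zp_inj; lia.
rewrite x1 in recw *.
move: recw; rewrite -[(v, 1%g)]/(emb v) !sec_conj_emb -embX -embD.
move/(congr1 (@fst _ _)) => recV.
have recv : act (zp (4 * k%:Z)) v + v = act (zp (2 * k%:Z)) v *+ T by exact: recV.
have v2 : v.2 = 0.
  have := congr1 (@snd _ _) recv.
  rewrite (val1D _ _).2 (act_zp (4 * _) _).2 (val1_mulrn _ _).2 (act_zp (2 * _) _).2.
  rewrite -mulr_natr natz => H; have : v.2 * (T%:Z - 2) = 0 by rewrite mulrBr -H; ring.
  by move/eqP; rewrite mulf_eq0 => /orP[/eqP->|/eqP]; lia.
by exists v.1; case: v v2 {recv recV} => m' n /= ->.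
Qed.

Lemma aut_embZ (u : F) (z : int) v : w (emb u) = emb v -> w (emb (u *~ z)) = emb (v *~ z).
Proof.
have embV x : emb (- x) = (emb x)^-1%g.
  by apply: (mulgI (emb x)); rewrite -embD subrr mulgV.
move=> uv; case: z => n; first by rewrite -!pmulrn !embX autX uv.
by rewrite !NegzE !mulrNz !embV autV -!pmulrn !embX autX uv.
Qed.

(** The induced additive map of [O] commutes with multiplication by
    [eps ^ k = p + q s], where [q <> 0], hence with multiplication by [s]. *)
Lemma aut_scalar_on_O : exists2 l, l != 0 &
  forall m, exists2 m', w (emb (m, 0)) = emb (m', 0) & qo_val m' = l * qo_val m.
Proof.
have /choice[phi phiE] : forall m, exists m', w (emb (m, 0)) = emb (m', 0) := aut_preserves_O.
have phiD m m' : phi (m + m') = phi m + phi m'.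
  have : w (emb ((m, 0) + (m', 0))) = (emb (phi m, 0) * emb (phi m', 0))%g.
    by rewrite embD autM !phiE.
  rewrite -embD; have -> : (m, 0) + (m', 0) = (m + m', 0) :> F.
    by apply: quad_pairP => //=; rewrite addr0.
  by rewrite phiE => /(congr1 (fun g : Gam => g.1.1)).
have phiZ m (z : int) : phi (m *~ z) = phi m *~ z.
  have := aut_embZ z (phiE m).
  have E x : (x, 0) *~ z = (x *~ z, 0) :> F by rewrite mulrz_pair /= mul0rz.
  by rewrite !E phiE => /(congr1 (fun g : Gam => g.1.1)).
have phiA m m' : qo_val m' = e ^ k%:Z * qo_val m ->
    qo_val (phi m') = e ^ k%:Z * qo_val (phi m).
  move=> mm'.
  have : w (sec (zp (1 * k%:Z)) * emb (m, 0) * (sec (zp (1 * k%:Z)))^-1)%g =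
      emb (phi m', 0).
    rewrite sec_conj_emb -phiE; congr (w (emb _)); apply: quad_pairP.
      by rewrite (act_zp _ _).1 mul1r mm'.
    by rewrite (act_zp _ _).2.
  rewrite !autM autV aut_fixes_sec_zp phiE sec_conj_emb mul1r.
  move=> H; have <- : val1 (act (zp k%:Z) (phi m, 0)) = qo_val (phi m').
    exact: (congr1 (fun g : Gam => qo_val g.1.1) H).
  by rewrite (act_zp _ _).1.
have [p [q [pq q0 _]]] := eps_exp_coord intK_inj sE bar_s eO eps_norm eps_inf
  (i := k%:Z) (lt0n_neq0 k_gt0).
pose l := qo_val (phi oneO).
have phi_sqrt : qo_val (phi sqrtO) = s * l.
  have h : qo_val (oneO *~ p + sqrtO *~ q) = e ^ k%:Z * qo_val oneO.
    by rewrite valD !val_mulrz pq mulr1 mul1r [s * _]mulrC.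
  have := phiA _ _ h; rewrite phiD !phiZ valD !val_mulrz pq -/l.
  have q0' : q%:~R != 0 :> K by rewrite intK_eq0.
  move=> H; apply: (mulIf q0'); apply: (addrI (l * p%:~R)); rewrite H; ring.
have phiE' m : qo_val (phi m) = l * qo_val m.
  have [a [b ->]] := quad_order_coord m.
  rewrite phiD !phiZ !valD !val_mulrz phi_sqrt.
  by rewrite -[qo_val oneO]/1 -[qo_val sqrtO]/s -/l; ring.
exists l; last by move=> m; exists (phi m).
apply/eqP => l0; have : w (emb (oneO, 0)) = w 1%g.
  rewrite phiE aut1; congr (_, _); exact: quad_pairP.
move/aut_inj/emb_eq1/(congr1 (fun u : F => val1 u)) => /= /eqP.
by rewrite oner_eq0.
Qed.

Lemma aut_intertwines y v x u u' : w (sec y) = (v, x) -> w (emb u) = emb u' ->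
  w (emb (act y u)) = emb (act x u').
Proof.
move=> wy wu; have := congr1 w (sec_emb y u); rewrite !autM wy wu.
move=> H; apply: (mulIg ((v, x) : Gam)); rewrite -H !gamM /=.
by rewrite act_one mulg1 mul1g addrC.
Qed.

Lemma eps_fixed_eq0 i (m : K) : i != 0 -> e ^ i * m = m -> m = 0.
Proof.
move=> i0 /eqP; rewrite -{2}[m]mul1r -subr_eq0 -mulrBl mulf_eq0 subr_eq0.
case/orP => /eqP //; rewrite -[1](expr0z e) => /e_inj iE.
by rewrite iE in i0.
Qed.

(** The image of [(0, 1)] commutes with [A ^ k], so it is a rotation whose
    component in [O] vanishes; it also commutes with the image of [O], so the
    rotation is trivial. *)
Lemma aut_scalar_on_Z : exists c, forall n, w (emb (0, n)) = emb (0, n * c).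
Proof.
have [l l0 wl] := aut_scalar_on_O.
case wE : (w (emb (0, 1))) => [v x].
have zk := aut_fixes_sec_zp 1; rewrite mul1r in zk.
have k0 : k%:Z != 0 by rewrite lt0n_neq0.
have com : (sec (zp k%:Z) * ((v, x) : Gam) = ((v, x) : Gam) * sec (zp k%:Z))%g.
  rewrite -wE -zk -!autM sec_emb; congr (w (emb _ * _)%g); apply: quad_pairP.
    by rewrite (act_zp _ _).1 mulr0.
  by rewrite (act_zp _ _).2.
have v1 : val1 v = 0.
  have := congr1 (@fst _ _) com; rewrite !gamM /= act_zero addr0 add0r => vE.
  by apply: (eps_fixed_eq0 k0); rewrite -(act_zp _ _).1 vE.
have x1 : x = 1%g.
  have [i [xE|xE]] := dih_normal_form D_dih x; last first.
    have : (zp k%:Z * x = x * zp k%:Z)%g := congr1 (@snd _ _) com.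
    rewrite xE -!mulgA.
    rewrite (dih_tau_zp D_dih) !mulgA -!expgzD => /mulIg/zp_inj; lia.
  have [m' wm' m'E] := wl oneO.
  have := congr1 w (emb_comm (0, 1) (oneO, 0)); rewrite !autM wm' wE !gamM /=.
  rewrite act_one mul1g mulg1 => /(congr1 (@fst _ _)) /= H.
  have {}H : act x (m', 0) = (m', 0) by apply: (addrI v); rewrite H addrC.
  have [i0|i0] := eqVneq i 0; first by rewrite xE i0.
  have : l = 0; last by move/eqP; rewrite (negPf l0).
  apply: (eps_fixed_eq0 i0); have := (act_zp i (m', 0)).1.
  by rewrite -xE H /= m'E mulr1.
exists v.2 => n; have := aut_embZ n (_ : w (emb (0, 1)) = emb v).
rewrite wE x1 !mulrz_pair /= => /(_ erefl).
rewrite mul0rz -mulrzr mul1r intz => ->; congr emb; apply: quad_pairP; rewrite /=.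
  by rewrite val_mulrz v1 mul0r.
by rewrite -mulrzr intz mulrC.
Qed.

(** Modulo [F], the image of [tau] is a reflection [A ^ j tau], as it acts on [O]
    like [bar] up to conjugation by [l]; evaluating at [1] gives the relation. *)
Lemma aut_tau_twist l : l != 0 ->
  (forall m, exists2 m', w (emb (m, 0)) = emb (m', 0) & qo_val m' = l * qo_val m) ->
  exists j, e ^ j * bar l = l.
Proof.
move=> l0 wl; case wE : (w (sec tau)) => [v x].
have key (m : quad_order s) :
    exists2 u : F, val1 u = l * qo_val m & val1 (act x u) = l * bar (qo_val m).
  have [m' wm mE] := wl m; exists (m', 0) => //.
  have wt := aut_intertwines wE wm; have [m'' wm'' m''E] := wl (act tau (m, 0)).1.
  have tE : act tau (m, 0) = ((act tau (m, 0)).1, 0).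
    by rewrite [LHS]surjective_pairing (act_tau m 0).2 oppr0.
  move: wt; rewrite tE wm'' => /(congr1 (fun g : Gam => val1 g.1)) /= <-.
  by rewrite m''E (act_tau m 0).1.
have [i [xE|xE]] := dih_normal_form D_dih x.
  have [u uE aE] := key oneO; have [u' uE' aE'] := key sqrtO.
  move: aE aE'; rewrite xE !(act_zp _ _).1 uE uE' /= rmorph1 bar_s mulr1.
  have [->|i0] := eqVneq i 0; last by move/(eps_fixed_eq0 i0)/eqP; rewrite (negPf l0).
  rewrite expr0z !mul1r mulrN => _ /eqP.
  rewrite -subr_eq0 opprK -mulr2n -mulr_natr !mulf_eq0 (negPf l0).
  rewrite -[2%:R]/((2 : int)%:~R).
  by rewrite (intK_eq0 intK_inj) orbF (negPf (s_neq0 d_nonsquare intK_inj sE)).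
have [u uE] := key oneO; rewrite xE (act_refl _ _).1 uE /= rmorph1 !mulr1.
by exists i.
Qed.
End Normalised.

Lemma autVK (w : AutG Gam) g : w^-1%g (w g) = g.
Proof. by rewrite -aut_mulE mulVg. Qed.

Lemma int_unit_sqr (N N' : int) : N * N' = 1 -> N ^+ 2 = 1.
Proof.
move=> NN; have : `|N| = 1.
  have := congr1 (fun z : int => `|z|%N) NN; rewrite abszM => /eqP.
  by rewrite muln_eq1 => /andP[/eqP h _]; lia.
by rewrite -[N ^+ 2]real_normK ?num_real // => ->.
Qed.

(** The norm [N] of [l] is a unit of the integers, so [eps ^ j * bar l = l] gives
    [l ^ 2 = eps ^ j N] and [l ^ 4 = eps ^ (2 j)]; the scalar on the second factor
    is a sign, and disappears in the fourth power. *)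
Lemma aut4_on_F (w : AutG Gam) k : (0 < k)%N -> w (sec A ^+ k)%g = (sec A ^+ k)%g ->
  exists j, forall u, (w ^+ 4)%g (emb u) = emb (act (zp (2 * j)) u).
Proof.
move=> k0 wA; have wA' : w^-1%g (sec A ^+ k)%g = (sec A ^+ k)%g by rewrite -{1}wA autVK.
have [l l0 wl] := aut_scalar_on_O k0 wA; have [l' _ wl'] := aut_scalar_on_O k0 wA'.
have [c wc] := aut_scalar_on_Z k0 wA; have [c' wc'] := aut_scalar_on_Z k0 wA'.
have [j lj] := aut_tau_twist l0 wl.
have [m1 wm1 m1E] := wl oneO; have [m2 wm2 m2E] := wl' m1.
have [m3 _ m3E] := wl' oneO.
rewrite mulr1 in m1E; rewrite mulr1 in m3E.
have ll' : l * l' = 1.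
  rewrite mulrC -m1E -m2E; have := autVK w (emb (oneO, 0)).
  by rewrite wm1 wm2 => /(congr1 (fun g : Gam => val1 g.1)).
have cc' : c * c' = 1.
  have := autVK w (emb (0, 1)); rewrite wc wc' => /(congr1 (fun g : Gam => g.1.2)) /=.
  by rewrite mul1r.
have [N NE] : exists N : int, l * bar l = N%:~R.
  by rewrite -m1E; exact: (norm_int sE bar_s (inO_qo _)).
have [N' NE'] : exists N : int, l' * bar l' = N%:~R.
  by rewrite -m3E; exact: (norm_int sE bar_s (inO_qo _)).
have N2 : N ^+ 2 = 1.
  apply: (@int_unit_sqr _ N'); apply: intK_inj; rewrite /= rmorphM /= -NE -NE'.
  by rewrite mulrACA ll' -rmorphM ll' rmorph1 mulr1.
have c2 := int_unit_sqr cc'.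
have l2 : l ^+ 2 = e ^ j * N%:~R.
  by rewrite -NE expr2 -{1}lj; ring.
have l4 : l ^+ 4 = e ^ (2 * j).
  rewrite (_ : l ^+ 4 = (l ^+ 2) ^+ 2); last by ring.
  by rewrite l2 exprMn -rmorphXn N2 mulr1 mulrC -exprz_exp.
exists j => u; rewrite -[(w ^+ 4)%g _]/(w (w (w (w _)))).
have -> : u = (u.1, 0) + (0, u.2).
  by apply: quad_pairP; rewrite /= ?addr0 ?add0r.
rewrite act_add !embD !autM !wc.
have [a1 -> a1E] := wl u.1; have [a2 -> a2E] := wl a1.
have [a3 -> a3E] := wl a2; have [a4 -> a4E] := wl a3.
congr (emb _ * emb _)%g; apply: quad_pairP.
- rewrite (act_zp _ _).1 /= a4E a3E a2E a1E -l4; ring.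
- by rewrite (act_zp _ _).2.
- by rewrite (act_zp _ _).1 mulr0.
- rewrite (act_zp _ _).2 /=.
  have -> : u.2 * c * c * c * c = u.2 * (c ^+ 2) ^+ 2 by ring.
  by rewrite c2 expr1n mulr1.
Qed.

(** Since [w] fixes [F], it induces the identity on [D] by faithfulness, so it
    moves [A] and [tau] by elements of [F].  The one for [A] vanishes because
    [A ^ k] is fixed, and the one for [tau] is also fixed by the shear. *)
Lemma trivial_on_F_comm_shear (w th : AutG Gam) k :
  (0 < k)%N -> w (sec A ^+ k)%g = (sec A ^+ k)%g ->
  (forall u, w (emb u) = emb u) -> (forall u, th (emb u) = emb u) ->
  th (sec A) = (emb (0, 1%R) * sec A)%g -> th (sec tau) = sec tau ->
  commute w th.
Proof.
move=> k0 wA wF thF thA tht.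
have w2 y : exists v, w (sec y) = (emb v * sec y)%g.
  case wE : (w (sec y)) => [v x]; exists v; rewrite [LHS]gam_split /=.
  suff -> : x = y by [].
  apply/divg1_eq/act_faithful => u.
  have := aut_intertwines wE (wF (act (y^-1)%g u)).
  rewrite wF -act_mul mulgV act_one -act_mul.
  by move/(congr1 (@fst _ _)) => /esym.
have wsA : w (sec A) = sec A.
  have [v wv] := w2 A.
  have vk : v = act (zp k%:Z) v.
    have : (emb v * (sec A * sec A ^+ k) =
            emb (act (zp k%:Z) v) * (sec A * sec A ^+ k))%g.
      have cA : (sec A * sec A ^+ k = sec A ^+ k * sec A)%g.
        exact: commuteX (commute_refl _).
      have := congr1 w cA; rewrite !autM wA wv => H.
      by rewrite mulgA H cA !mulgA -[(sec A ^+ k)%g]secX sec_emb.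
    by move/mulIg/(congr1 (@fst _ _)).
  have v1 : val1 v = 0.
    by apply: (eps_fixed_eq0 (i := k%:Z)); rewrite ?lt0n_neq0 // -(act_zp _ _).1 -vk.
  have cvA : commute (emb v) (sec A).
    rewrite /commute sec_emb; congr (emb _ * _)%g; apply: quad_pairP.
      by rewrite (act_zp 1 _).1 v1 mulr0.
    by rewrite (act_zp 1 _).2.
  have : (emb v ^+ k)%g = 1%g.
    apply: (mulIg (sec A ^+ k)%g); rewrite mul1g -expgMn // -wv -autX wA //.
  rewrite -embX => /emb_eq1/(congr1 (@snd _ _)); rewrite (val1_mulrn _ _).2 /= => /eqP.
  rewrite mulrn_eq0 -leqn0 leqNgt k0 /= => /eqP v20.
  by rewrite wv (_ : v = 0) ?emb0 ?mul1g //; apply: quad_pairP.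
have [v wt] := w2 tau.
apply: aut_ext => [u||]; rewrite !aut_mulE.
- by rewrite thF !wF thF.
- by rewrite thA autM wF wsA thA.
- by rewrite tht wt autM thF tht.
Qed.

Section NonArithmetic.
Variables (R : realType) (H : set (AutG Gam)).
Hypotheses (HS : is_subgroup H) (Hfin : finite_index H setT).

(** The isomorphism [f] onto an arithmetic group transports the element provided
    by [arithmetic_unipotent_part] back to an automorphism [w], whose fourth power
    contradicts one of the two properties according to its twist [j]. *)
Theorem Aut_not_arithmetic : ~ arithmetic_group R H.
Proof.
move=> [n [G [Delta [GQ GD [f [[fHD finj fsurj] fM]]]]]].
have fin x : exists2 k, (0 < k)%N & H (x ^+ k)%g.
  exact: finite_index_exp HS Hfin (fun=> I).
have f1 : f 1%g = 1%g.
  have H1 : H 1%g by case: HS.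
  by apply: (mulgI (f 1%g)); rewrite -fM // !mulg1.
have fV x : H x -> f (x^-1)%g = (f x)^-1%g.
  move=> Hx; apply: (mulgI (f x)); rewrite -fM ?mulgV ?f1 //.
  exact: subgroupV.
have fX x k : H x -> f (x ^+ k)%g = (f x ^+ k)%g.
  move=> Hx; elim: k => [|k IH]; first by rewrite !expg0 f1.
  by rewrite !expgS fM ?IH //; apply: subgroupX.
have finj' x y : H x -> H y -> f x = f y -> x = y.
  by move=> Hx Hy; apply: finj; rewrite inE.
have [k k0 Hk] := fin (inn (sec A)); set a := (inn (sec A) ^+ k)%g in Hk.
have [v [Dv vC vU vS]] := arithmetic_unipotent_part GQ GD (fHD _ Hk).
have [w Hw wv] := fsurj _ Dv.
have wa : commute w a.
  apply: finj'; [exact: subgroupM|exact: subgroupM|rewrite !fM // wv].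
  by apply: vC (fHD _ Hk) _; apply: commute_refl.
have wA : w (sec A ^+ k)%g = (sec A ^+ k)%g.
  apply: inn_inj_gam; rewrite -inn_conj innX -/a.
  by rewrite -commuteE.
have [j w4] := aut4_on_F k0 wA.
have Hw4 : H (w ^+ 4)%g by apply: subgroupX.
have fw4 : f (w ^+ 4)%g = (v ^+ 4)%g by rewrite fX // wv.
have [j0|j0] := eqVneq j 0.
  have w4F u : (w ^+ 4)%g (emb u) = emb u by rewrite w4 j0 mulr0 act_one.
  have [th [thF thA tht]] := exists_shear.
  have w4A : (w ^+ 4)%g (sec A ^+ k)%g = (sec A ^+ k)%g.
    by rewrite -[(w ^+ 4)%g _]/(w (w (w (w _)))) !wA.
  have wth := trivial_on_F_comm_shear k0 w4A w4F thF thA tht.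
  have [l l0 Hl] := fin th.
  pose zv : F := (0, 1).
  have zA : commute (emb zv) (sec A).
    rewrite /commute sec_emb; congr (emb _ * _)%g; apply: quad_pairP.
      by rewrite (act_zp 1 _).1 mulr0.
    by rewrite (act_zp 1 _).2.
  have thl_F i u : (th ^+ i)%g (emb u) = emb u.
    by elim: i => [//|i IH]; rewrite expgS aut_mulE IH thF.
  have thlA i : (th ^+ i)%g (sec A) = (emb zv ^+ i * sec A)%g.
    elim: i => [|i IH]; first by rewrite mul1g.
    by rewrite expgSr aut_mulE thA autM thl_F IH mulgA -expgS.
  pose z := inn (emb zv ^+ (l * k))%g.
  have rel : (th ^+ l * a * (th ^+ l)^-1 = z * a)%g.
    rewrite /a /z -innX inn_conj autX thlA expgMn; last first.
      by apply: commute_sym; apply: commuteX; apply: commute_sym.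
    by rewrite innM -expgnA.
  have Hz : H z.
    have -> : z = (th ^+ l * a * (th ^+ l)^-1 * a^-1)%g by rewrite rel mulgK.
    by do !apply: subgroupM => //; apply: subgroupV.
  have za : commute z a.
    rewrite /commute /z /a -innX -!innM; congr inn.
    by apply: commuteX2.
  have zt : commute z (th ^+ l)%g.
    apply: commute_sym; apply/commuteE.
    by rewrite inn_conj autX thl_F.
  have Hta : H (th ^+ l * a)%g by apply: subgroupM.
  have HtV : H (th ^- l)%g by apply: subgroupV.
  have [|||||||m m0] := vS 4 (f (th ^+ l)%g) (f z).
  - by [].
  - exact: fHD.
  - exact: fHD.
  - by rewrite /commute -!fM // za.
  - by rewrite /commute -!fM // zt.
  - by rewrite -fw4 /commute -!fM // (commuteX l wth).
  - by rewrite -fV // -!fM // rel.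
  rewrite -fX // -f1 => /finj' zm.
  have : emb (zv *+ (l * k * m)) = 1%g.
    apply: inn_inj_gam; rewrite inn1 embX expgnA innX; apply: zm.
      exact: subgroupX.
    by case: HS.
  move/emb_eq1/(congr1 (@snd _ _)); rewrite (val1_mulrn _ _).2 /= => /eqP.
  by rewrite mulrn_eq0 /= orbF -leqn0 leqNgt !muln_gt0 l0 k0 m0.
have [T [T2 _ Te]] := eps_trace d_nonsquare intK_inj sE bar_s eO eps_norm eps_inf j0.
have [q q0 Hq] := fin (inn (emb (oneO, 0))).
pose u : F := (oneO, 0) *+ q.
have HX : H (inn (emb u)) by rewrite /u embX innX.
have w4X y : (w ^+ 4 * inn (emb y) * (w ^+ 4)^-1)%g = inn (emb (act (zp (2 * j)) y)).
  by rewrite inn_conj w4.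
have HwX : H (w ^+ 4 * inn (emb u))%g by apply: subgroupM.
have HwXw : H (w ^+ 4 * inn (emb u) * (w ^+ 4)^-1)%g.
  by apply: subgroupM => //; apply: subgroupV.
have fconj y : H (inn (emb y)) -> (v ^+ 4 * f (inn (emb y)) * (v ^+ 4)^-1)%g =
    f (inn (emb (act (zp (2 * j)) y))) /\ H (inn (emb (act (zp (2 * j)) y))).
  move=> Hy; have HV : H (w ^+ 4)^-1%g by apply: subgroupV.
  have Hwy : H (w ^+ 4 * inn (emb y))%g by apply: subgroupM.
  rewrite -fw4 -fV // -!fM // w4X; split=> //.
  by rewrite -w4X; apply: subgroupM.
have [b1E Hb1] := fconj u HX; have [b2E Hb2] := fconj _ Hb1.
have : (f (inn (emb u)) ^+ (T - 2) = 1)%g.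
  apply: (vU 4 _ _ T2); rewrite b1E.
    rewrite /commute -!fM // -!innM; congr (f (inn _)); exact: emb_comm.
  have -> : ((v ^+ 4) ^+ 2 * f (inn (emb u)) * (v ^+ 4) ^- 2 =
      v ^+ 4 * (v ^+ 4 * f (inn (emb u)) * (v ^+ 4)^-1) * (v ^+ 4)^-1)%g.
    by rewrite expg2 invgM !mulgA.
  rewrite b1E b2E -fM // -fX // -innM -innX -embD -embX.
  congr (f (inn (emb _))); apply: quad_pairP.
    rewrite (val1_mulrn _ _).1 (val1D _ _).1 !(act_zp _ _).1.
    rewrite mulrA -expfzDr // -[X in _ + X]mul1r -mulrDl.
    have -> : 2 * j + 2 * j = j * 4 by ring.
    by rewrite Te -mulrA (mulr_natl _ T) [j * 2]mulrC.
  rewrite (val1_mulrn _ _).2 (val1D _ _).2 !(act_zp _ _).2.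
  by rewrite /u (val1_mulrn _ _).2 !mul0rn.
rewrite -fX // -f1 => /finj' XT.
have : emb (u *+ (T - 2)) = 1%g.
  apply: inn_inj_gam; rewrite inn1 embX innX; apply: XT.
    exact: subgroupX.
  by case: HS.
rewrite /u -mulrnA => /emb_eq1/(congr1 (fun y : F => val1 y)).
rewrite (val1_mulrn _ _).1 /= pmulrn => /eqP; rewrite (intK_eq0 intK_inj) => /eqP.
by have : (0 < q * (T - 2))%N by [rewrite muln_gt0 q0 subn_gt0]; lia.
Qed.
End NonArithmetic.
End Gamma.

Theorem theorem1p2 (R : realType)
  (d : nat) (d_nonsquare : forall k : nat, d <> (k ^ 2)%N)
  (K : splittingFieldType rat) (sqrt_d : K)
  (sqrt_dE : sqrt_d ^+ 2 = d%:R)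
  (K_gen : <<1%AS; sqrt_d>>%VS = fullv)
  (bar : gal_of {:K})
  (bar_gal : bar \in ('Gal({:K} / 1%AS))%g)
  (bar_nontrivial : bar <> 1%g)
  (eps : quad_order sqrt_d)
  (eps_unit : exists eta : quad_order sqrt_d, qo_val eps * qo_val eta = 1)
  (eps_infinite : forall k : nat, (0 < k)%N -> qo_val eps ^+ k <> 1)
  (eps_norm : qo_val eps * bar (qo_val eps) = 1)
  (D : groupType) (A tau : D) (D_dihedral : infinite_dihedral A tau)
  (act : group_action D (quad_order sqrt_d * int)%type)
  (act_A : forall (m : quad_order sqrt_d) (n : int),
     qo_val (act A (m, n)).1 = qo_val eps * qo_val m /\
     (act A (m, n)).2 = n)
  (act_tau : forall (m : quad_order sqrt_d) (n : int),
     qo_val (act tau (m, n)).1 = bar (qo_val m) /\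
     (act tau (m, n)).2 = - n)
  (H : set (AutG (semidirect act))) :
  is_subgroup H -> finite_index H setT -> ~ arithmetic_group R H.
Proof.
move=> HS Hfin.
apply: (Aut_not_arithmetic d_nonsquare (@intr_inj_rat_alg K) sqrt_dE (bar := bar) _
  eps_norm eps_infinite D_dihedral act_A act_tau HS Hfin).
exact: gal_nontrivial_sqrt sqrt_dE K_gen bar_nontrivial.
Qed.
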